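(* For every $3/2< p\leq 2$ there is a constant $C_p>0$ such that for all $N\in\mathbb{N}$ and every function $f:\mathbb{Z}\to\mathbb{R}$, $$\|A_{N}f\|_{p'}\leq C_p\, N^{2/p'-2/p}\|f\|_p,$$ where $A_N f(x)=\frac{1}{N}\sum_{k=1}^{N} f(x+k^2)$ for $x\in\mathbb{Z}$.
   Context: For $f:\mathbb{Z}\to\mathbb{R}$, $\|f\|_p$ denotes the $\ell^p(\mathbb{Z})$-norm, and $p'=\frac{p}{p-1}$ is the conjugate exponent. *)

(* Defs.v *)
From mathcomp Require Import all_boot all_order all_algebra.
From mathcomp Require Import all_classical all_reals all_analysis.
Set Implicit Arguments. Unset Strict Implicit. Unset Printing Implicit Defensive.
Import Order.TTheory GRing.Theory Num.Theory.
Local Open Scope ring_scope.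
Local Open Scope classical_set_scope.

Definition lpnorm {R : realType} (p : R) (f : int -> R) : \bar R :=
  ((\esum_(x in [set: int]) ((`|f x| `^ p)%:E)) `^ p^-1)%E.

Definition conj_exp {R : realType} (p : R) : R := p / (p - 1).

Definition avg_sq {R : realType} (N : nat) (f : int -> R) (x : int) : R :=
  N%:R^-1 * \sum_(1 <= k < N.+1) f (x + (k ^ 2)%:Z)%R.

(* Main.v *)
Require Import Defs.
From mathcomp Require Import all_boot all_order all_algebra.
From mathcomp Require Import all_classical all_reals all_analysis.
From mathcomp Require Import zify ring lra.
Set Implicit Arguments. Unset Strict Implicit. Unset Printing Implicit Defensive.
Import Order.TTheory GRing.Theory Num.Theory.
Import numFieldNormedType.Exports.
Local Open Scope ring_scope.

(** Duality and a decomposition of both functions into level sets reduce the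
    theorem to the bound [B(F, G) <= C N^(1/3) (|F| |G|)^(2/3)] for the number
    [B(F, G)] of pairs [(x, y)] in [F * G] with [y - x = k^2], [1 <= k <= N]:
    pairs of levels with a small product are controlled by the row and column
    sums of the graph, the others by this bound, whose exponent [2/3 > 1/p]
    makes the sum over the levels geometric.

    For [k] in [[M, 2M)] and [F], [G] in intervals of length [M^2],
    Cauchy-Schwarz gives [B^2 <= |G| S(F)], where [S(F)] counts the pairs
    [x, x'] in [F] and the [v] in [[2M, 4M)] with [v %| x - x']: indeed
    [x + k^2 = x' + l^2] forces [k + l] to divide [x - x'].  Expanding
    [v %| x - x'] into additive characters turns [S(F)] into a sum over
    fractions [a / q] with [q < 4M] of [|\hat F(a / q)|^2], with weight at most
    [2 / q].  The fractions with [q > Q] contribute at most [C M^2 |F| / Q] by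
    the large sieve; those with [q <= Q] are folded back into congruences
    modulo [q] and controlled by the fourth moment of the number of divisors
    at most [Q].  No logarithm is lost if [Q] is a power of [M^2 / |F|]. *)

(** * Trigonometric sums over residues *)

Section Trigonometry.
Variable R : realType.
Implicit Types (x y h : R) (n z : int) (v : nat).

Lemma sin_shift_2pi x z : sin (x + z%:~R * (2 * pi)) = sin x.
Proof.
have P m u : sin (u + m%:R * (2 * pi)) = sin u :> R.
  by rewrite [2 * pi]mulr_natl [m%:R * _]mulr_natl (periodicn (@sinD2pi R)).
case: z => m; first by rewrite -pmulrn P.
by rewrite NegzE mulrNz -pmulrn -(P m.+1 (x + _)) mulNr subrK.
Qed.

Lemma cos_shift_2pi x z : cos (x + z%:~R * (2 * pi)) = cos x.
Proof. by rewrite -!sinDpihalf addrAC sin_shift_2pi. Qed.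

(** Since [cos (2 y) = 1 - 2 sin^2 y], the square of the sine at [pi n / v] depends only on [n]
    modulo [v]. Replacing [n] by its residue [r] puts the argument strictly between [0] and [pi]. *)
Lemma sin_pi_frac_neq0 n v : (0 < v)%N -> ~~ (v %| n)%Z ->
  sin (pi * n%:~R / v%:R) != 0 :> R.
Proof.
move=> v0 nv; apply/eqP => s0.
have vR : 0 < v%:R :> R by rewrite ltr0n.
set r := (n %% v)%Z; have r0 : (0 < r)%R.
  by rewrite lt_neqAle eq_sym modz_ge0 ?andbT; [apply: contraNneq nv => e; apply/dvdz_mod0P|lia].
have rv : (r < v)%R by rewrite /r ltz_pmod //; lia.
have cE y : cos (2 * y) = 1 - 2 * sin y ^+ 2 :> R.
  by rewrite mulr_natl cos_mulr2n cos2sin2 mulrnBl mulr_natl; ring.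
have e : cos (2 * (pi * n%:~R / v%:R)) = cos (2 * (pi * r%:~R / v%:R)) :> R.
  rewrite -[RHS](cos_shift_2pi _ (n %/ v)%Z); congr cos.
  rewrite [in LHS](divz_eq n v) -/r rmorphD rmorphM /=.
  by rewrite -pmulrn; field; rewrite gt_eqF.
have : 0 < sin (pi * r%:~R / v%:R) :> R.
  apply: sin_gt0_pi; rewrite divr_gt0 ?mulr_gt0 ?pi_gt0 ?ltr0z //=.
  by rewrite ltr_pdivrMr // ltr_pM2l ?pi_gt0 // pmulrn ltr_int.
by move: e; rewrite !cE s0; nra.
Qed.

(** Orthogonality of characters: with [y = pi n / v], multiplying by [2 sin y], which is nonzero,
    makes the sum telescope over a full period. The shift [h] is there for the half-integer
    frequencies met when consecutive exponential sums are subtracted. *)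
Lemma sum_cos_shift v n h : (0 < v)%N -> ~~ (v %| n)%Z ->
  \sum_(0 <= a < v) cos ((a%:R + h) * (2 * pi * n%:~R / v%:R)) = 0 :> R.
Proof.
move=> v0 nv; pose y : R := pi * n%:~R / v%:R.
have vR : 0 < v%:R :> R by rewrite ltr0n.
apply: (mulfI (sin_pi_frac_neq0 v0 nv)); rewrite mulr0 big_distrr /= -/y.
apply: (@mulfI _ 2); rewrite // mulr0 big_distrr /=.
pose G a : R := sin ((2 * (a%:R + h) - 1) * y).
rewrite (eq_bigr (fun a => G a.+1 - G a)) => [|a _].
  rewrite telescope_sumr // /G.
  have -> : (2 * (v%:R + h) - 1) * y = (2 * (0%:R + h) - 1) * y + n%:~R * (2 * pi).
    by rewrite /y; field; rewrite gt_eqF.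
  by rewrite sin_shift_2pi subrr.
rewrite /G.
have -> : (a%:R + h) * (2 * pi * n%:~R / v%:R) = 2 * (a%:R + h) * y by rewrite /y; ring.
have -> : (2 * (a.+1%:R + h) - 1) * y = 2 * (a%:R + h) * y + y by rewrite -natr1; ring.
have -> : (2 * (a%:R + h) - 1) * y = 2 * (a%:R + h) * y - y by ring.
by rewrite sinD sinB; ring.
Qed.

Lemma sum_cos_dvd v n : (0 < v)%N -> (v %| n)%Z ->
  \sum_(0 <= a < v) cos (a%:R * (2 * pi * n%:~R / v%:R)) = v%:R :> R.
Proof.
move=> v0 /dvdzP[k ->]; have vR : 0 < v%:R :> R by rewrite ltr0n.
rewrite (eq_bigr (fun=> 1)) => [|a _].
  by rewrite big_const_nat iter_addr subn0 addr0.
rewrite -[RHS](cos0 R) -[RHS](cos_shift_2pi 0 (a%:Z * k)); congr cos.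
by rewrite !intrM -!pmulrn; field; rewrite gt_eqF.
Qed.

Lemma normr_sin_le x : `|sin x| <= `|x|.
Proof.
wlog x0 : x / 0 <= x => [hw|].
  by have [/hw//|/ltW x0] := leP 0 x; rewrite -normrN -sinN -(normrN x) hw ?oppr_ge0.
have [->|xn0] := eqVneq x 0; first by rewrite sin0.
have xgt : 0 < x by rewrite lt_def xn0.
have [|c _] := @MVT R (@sin R) (@cos R) 0 x xgt (fun y _ => is_derive_sin y).
  by apply: continuous_subspaceT => y; exact: continuous_sin.
rewrite sin0 !subr0 => ->; rewrite normrM ler_piMl //.
by rewrite ler_norml cos_geN1 cos_le1.
Qed.

End Trigonometry.

(** * Exponential sums over finite sets: Parseval and windows *)

Section Energy.
Variable R : realType.
Implicit Types (D v : nat) (b : int -> R) (F : seq int) (s h : R).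

Definition angle D (x : int) : R := 2 * pi * x%:~R / D%:R.

(* [|\sum_(x <- F) b x * exp (i s angle x)|^2] *)
Definition energy D b F s : R :=
  (\sum_(x <- F) b x * cos (s * angle D x)) ^+ 2 +
  (\sum_(x <- F) b x * sin (s * angle D x)) ^+ 2.

Lemma energy_ge0 D b F s : 0 <= energy D b F s.
Proof. by rewrite addr_ge0 ?sqr_ge0. Qed.

Lemma energyE D b F s : energy D b F s =
  \sum_(x <- F) \sum_(y <- F) b x * b y * cos (s * angle D (x - y)).
Proof.
rewrite /energy !expr2 !big_distrlr /= -big_split; apply: eq_bigr => x _ /=.
rewrite -big_split; apply: eq_bigr => y _ /=.
rewrite /angle rmorphB /= mulrBr mulrBl mulrBr cosB; ring.
Qed.

(** Parseval on [Z / D]: the points of [F] are distinct modulo [D], so orthogonality kills every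
    off-diagonal term, whatever the shift. *)
Lemma sum_energy D b F h : (0 < D)%N -> uniq F ->
  {in F &, forall x y, (D %| x - y)%Z -> x = y} ->
  \sum_(0 <= t < D) energy D b F (t%:R + h) = D%:R * \sum_(x <- F) b x ^+ 2.
Proof.
move=> D0 uF sF; under eq_bigr do rewrite energyE.
rewrite exchange_big /= big_distrr /=; apply: eq_big_seq => x xF.
rewrite exchange_big /= (bigD1_seq x) //= [X in _ + X]big1_seq ?addr0.
  under eq_bigr do rewrite subrr /angle mulr0 mul0r mulr0 cos0 mulr1 -expr2.
  by rewrite big_const_nat iter_addr subn0 addr0 mulr_natl.
move=> y /andP[yx yF]; rewrite -big_distrr /=.
rewrite /angle sum_cos_shift ?mulr0 //.
by apply: contra yx => /sF -> //.
Qed.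

Lemma sum_multiples u v (G : nat -> R) : (0 < u)%N ->
  \sum_(0 <= t < u * v | (u %| t)%N) G t = \sum_(0 <= a < v) G (a * u)%N.
Proof.
move=> u0; elim: v => [|v IH]; first by rewrite muln0 !big_nil.
rewrite big_nat_recr //= -IH (big_cat_nat (n := (u * v)%N)) //=; last first.
  by rewrite leq_pmul2l.
congr (_ + _); rewrite mulnS addnC -[X in \sum_(X <= _ < _ | _) _]add0n big_addn.
rewrite addKn; case: u u0 {IH} => // u _.
rewrite big_ltn_cond //= add0n dvdn_mulr // big1_seq ?addr0 ?(mulnC v) //.
move=> t; rewrite mem_index_iota => /andP[dt /andP[t0 tu]].
by move: dt; rewrite dvdn_addl ?dvdn_mulr // gtnNdvd.
Qed.

(** The condition [D %| t * v] selects the frequencies [t / D] of the form [a / v]. Summing the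
    characters [a / v] over [a] detects divisibility by [v]. *)
Lemma sum_energy_dvd D v F : (0 < D)%N -> (0 < v)%N -> (v %| D)%N ->
  \sum_(0 <= t < D | (D %| t * v)%N) energy D (fun=> 1) F t%:R =
  v%:R * \sum_(x <- F) \sum_(y <- F) (v %| x - y)%Z%:R.
Proof.
move=> D0 v0 /dvdnP[u DE]; subst D.
have u0 : (0 < u)%N by case: u D0.
rewrite (eq_bigl (fun t => (u %| t)%N)) => [|t]; last by rewrite dvdn_pmul2r.
rewrite sum_multiples //; under eq_bigr do rewrite energyE.
rewrite exchange_big /= big_distrr /=; apply: eq_bigr => x _.
rewrite exchange_big /= big_distrr /=; apply: eq_bigr => y _.
under eq_bigr do rewrite !mul1r.
rewrite (eq_bigr (fun a => cos (a%:R * (2 * pi * (x - y)%:~R / v%:R)))).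
  have [/(sum_cos_dvd R v0) ->|nv] := boolP (v %| x - y)%Z; first by rewrite mulr1.
  rewrite mulr0 -[RHS](sum_cos_shift 0 v0 nv).
  by apply: eq_bigr => a _; rewrite addr0.
move=> a _; congr cos; rewrite /angle !natrM; field.
by rewrite !pnatr_eq0 -!lt0n u0 v0.
Qed.

Lemma telescope_window (e : nat -> R) m w t t' :
  (m <= t < m + w)%N -> (m <= t' < m + w)%N ->
  e t' <= e t + \sum_(m <= s < m + w) `|e s.+1 - e s|.
Proof.
have sub a c : (m <= a)%N -> (a <= c)%N -> (c <= m + w)%N ->
    `|e c - e a| <= \sum_(m <= s < m + w) `|e s.+1 - e s|.
  move=> ma ac cm; rewrite -telescope_sumr //.
  apply: (le_trans (ler_norm_sum _ _ _)).
  rewrite [leRHS](big_cat_nat (n := a)) ?(leq_trans ac) //=.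
  rewrite [X in _ + X](big_cat_nat (n := c)) //= addrCA lerDl.
  by rewrite addr_ge0 // sumr_ge0.
move=> /andP[mt tm] /andP[mt' tm']; rewrite -lerBlDl.
have [tt'|/ltnW tt'] := leqP t t'.
  by apply: le_trans (sub t t' mt tt' (ltnW tm')); exact: ler_norm.
by rewrite (le_trans _ (sub t' t mt' tt' (ltnW tm))) // distrC ler_norm.
Qed.

Lemma sum_windows P w (G : nat -> R) (T : pred nat) :
  \sum_(0 <= t < P * w | T t) G t =
  \sum_(0 <= j < P) \sum_(j * w <= t < j * w + w | T t) G t.
Proof.
elim: P => [|P IH]; first by rewrite mul0n !big_nil.
by rewrite big_nat_recr //= -IH mulSn addnC -big_cat_nat //= leq_addr.
Qed.

(** A window of length [w] holds at most one point of [T]. The value of [e] there exceeds its value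
    at any other point of the window by at most the variation; averaging over the window gives the
    two sums. *)
Lemma sum_sparse_le P w (e : nat -> R) (T : pred nat) : (0 < w)%N ->
  (forall t, 0 <= e t) ->
  (forall j t t', (j * w <= t < j * w + w)%N -> (j * w <= t' < j * w + w)%N ->
     T t -> T t' -> t = t') ->
  \sum_(0 <= t < P * w | T t) e t <=
  w%:R^-1 * \sum_(0 <= t < P * w) e t + \sum_(0 <= t < P * w) `|e t.+1 - e t|.
Proof.
move=> w0 e0 sT; have wR : 0 < w%:R :> R by rewrite ltr0n.
rewrite !sum_windows big_distrr -big_split /=; apply: ler_sum => j _.
have [/hasP[t0 t0w Tt0]|/hasPn nT] :=
    boolP (has T (index_iota (j * w) (j * w + w))); last first.
  rewrite big_seq_cond big1 => [|t /andP[/nT/negbTE -> //]].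
  by rewrite addr_ge0 ?mulr_ge0 ?invr_ge0 ?sumr_ge0 // ltW.
have t0w' := t0w; rewrite mem_index_iota in t0w'.
rewrite (big_rem t0) //= Tt0 big1_seq ?addr0; last first.
  move=> t /andP[Tt]; rewrite mem_rem_uniq ?iota_uniq // inE => /andP[tt0].
  rewrite mem_index_iota => tw; case/eqP: tt0.
  exact: (sT j).
rewrite -(ler_pM2l wR) mulrDr mulVKf ?gt_eqF //.
have -> : w%:R * e t0 = \sum_(j * w <= t < j * w + w) e t0.
  by rewrite sumr_const_nat addKn mulr_natl.
have -> (c : R) : w%:R * c = \sum_(j * w <= t < j * w + w) c.
  by rewrite sumr_const_nat addKn mulr_natl.
rewrite -big_split /= ler_sum_nat // => t tw.
exact: telescope_window.
Qed.

End Energy.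

(** * The large sieve inequality *)

Section LargeSieve.
Variable R : realType.
Implicit Types (D v : nat) (F : seq int).

Lemma sumr_const_seq (I : Type) (r : seq I) (c : R) : \sum_(i <- r) c = c *+ size r.
Proof. by rewrite big_const_seq count_predT iter_addr addr0. Qed.

Local Notation e D F t := (energy D (fun=> 1 : R) F t%:R).

(** From [exp (i (t + 1) u) - exp (i t u) = 2 i sin (u / 2) exp (i (t + 1/2) u)], the difference of
    two consecutive exponential sums is again such a sum, at a half-integer frequency. A difference
    of squares is then split by Young's inequality with a free parameter [k]. *)
Lemma energy_step D F (t : nat) (k : R) : 0 < k ->
  `|e D F t.+1 - e D F t| <=
  k / 2 * energy D (fun x => 2 * sin (angle R D x / 2)) F (t%:R + 2^-1) +
  k^-1 * (e D F t.+1 + e D F t).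
Proof.
move=> k0; set e' := energy _ (fun x => 2 * _) _ _.
have -> : e' = (\sum_(x <- F) 1 * cos (t.+1%:R * angle R D x) -
                \sum_(x <- F) 1 * cos (t%:R * angle R D x)) ^+ 2 +
               (\sum_(x <- F) 1 * sin (t.+1%:R * angle R D x) -
                \sum_(x <- F) 1 * sin (t%:R * angle R D x)) ^+ 2.
  have half x : t.+1%:R * angle R D x = (t%:R + 2^-1) * angle R D x + angle R D x / 2 /\
                t%:R * angle R D x = (t%:R + 2^-1) * angle R D x - angle R D x / 2.
    by rewrite -natr1; split; field.
  rewrite /e' /energy addrC -!sumrB; congr (_ + _).
    rewrite -sqrrN -sumrN; congr (_ ^+ 2); apply: eq_bigr => x _.
    by have [-> ->] := half x; rewrite cosD cosB; ring.
  congr (_ ^+ 2); apply: eq_bigr => x _.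
  by have [-> ->] := half x; rewrite sinD sinB; ring.
rewrite /energy.
move: (\sum_(x <- F) _) (\sum_(x <- F) _) (\sum_(x <- F) _) (\sum_(x <- F) _).
move=> c' a' c a.
have young x y : 2 * `|x * y| <= k * x ^+ 2 + k^-1 * y ^+ 2.
  rewrite normrM -(real_normK (num_real x)) -(real_normK (num_real y)).
  move: `|x| `|y| => {}x {}y; rewrite -subr_ge0.
  have -> : k * x ^+ 2 + k^-1 * y ^+ 2 - 2 * (x * y) = k * (x - k^-1 * y) ^+ 2.
    by field; rewrite gt_eqF.
  by rewrite mulr_ge0 ?sqr_ge0 // ltW.
have -> : a ^+ 2 + c ^+ 2 - (a' ^+ 2 + c' ^+ 2) =
          (a - a') * (a + a') + (c - c') * (c + c') by ring.
apply: (le_trans (ler_normD _ _)).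
have ya := young (a - a') (a + a'); have yc := young (c - c') (c + c').
have ki : 0 < k^-1 by rewrite invr_gt0.
have sqD x y : k^-1 * (x + y) ^+ 2 <= k^-1 * (2 * (x ^+ 2 + y ^+ 2)).
  rewrite ler_pM2l // -subr_ge0.
  have -> : 2 * (x ^+ 2 + y ^+ 2) - (x + y) ^+ 2 = (x - y) ^+ 2 by ring.
  exact: sqr_ge0.
have sa := sqD a a'; have sc := sqD c c'.
move: ki ya yc sa sc; move: k^-1 `|_| `|_| => ki n1 n2.
by move=> ? ? ? ? ?; lra.
Qed.

(* Gallagher's argument: the value at a point of a window is at most the average
   over the window plus the total variation there; both are summed by Parseval. *)
Lemma large_sieve P w H F (T : pred nat) : (0 < P)%N -> (0 < w)%N -> (0 < H)%N ->
  (H.*2 < P * w)%N -> uniq F -> {in F, forall x, `|x| <= H%:Z} ->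
  (forall j t t', (j * w <= t < j * w + w)%N -> (j * w <= t' < j * w + w)%N ->
     T t -> T t' -> t = t') ->
  \sum_(0 <= t < P * w | T t) e (P * w) F t <= (P + 34 * H)%:R * (size F)%:R.
Proof.
move=> P0 w0 H0 HD uF bF sT; set D := (P * w)%N.
have D0 : (0 < D)%N by rewrite muln_gt0 P0.
have DR : 0 < D%:R :> R by rewrite ltr0n.
have HR : 0 < H%:R :> R by rewrite ltr0n.
have wR : 0 < w%:R :> R by rewrite ltr0n.
have sF : {in F &, forall x y, (D %| x - y)%Z -> x = y}.
  move=> x y /bF xb /bF yb /dvdzP[k kE].
  have [k0|k0] := eqVneq k 0; first by move: kE; rewrite k0 mul0r; lia.
  have : (D%:Z <= `|x - y|)%R.
    by rewrite kE normrM ler_peMl //; lia.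
  have : (`|x - y| <= `|x| + `|y|)%R by apply: ler_normB.
  by move: HD; rewrite -/D; lia.
have sparse := sum_sparse_le P w0 (fun t => energy_ge0 D (fun=> 1 : R) F t%:R) sT.
rewrite -/D /= in sparse.
(* This [k] balances the two terms of [energy_step]: the weights [2 sin (angle / 2)] are at most
   [8 H / D = 8 / k], so the terms contribute [32 H |F|] and [2 H |F|], whence the constant [34]. *)
pose k : R := D%:R / H%:R; have k0 : 0 < k by rewrite divr_gt0.
have step : \sum_(0 <= t < D) `|e D F t.+1 - e D F t| <= k / 2 *
    \sum_(0 <= t < D) energy D (fun x => 2 * sin (angle R D x / 2)) F (t%:R + 2^-1) +
    k^-1 * (\sum_(0 <= t < D) e D F t.+1 + \sum_(0 <= t < D) e D F t).
  rewrite -big_split /= !big_distrr -big_split /=.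
  by apply: ler_sum => t _; exact: energy_step.
have S0 : \sum_(0 <= t < D) e D F t = D%:R * (size F)%:R.
  rewrite -[(size F)%:R](_ : \sum_(x <- F) 1 ^+ 2 = _); last first.
    by rewrite expr1n sumr_const_seq.
  rewrite -(sum_energy (fun=> 1) 0 D0 uF sF); apply: eq_bigr => t _.
  by rewrite addr0.
have S1 : \sum_(0 <= t < D) e D F t.+1 = D%:R * (size F)%:R.
  rewrite -[(size F)%:R](_ : \sum_(x <- F) 1 ^+ 2 = _); last first.
    by rewrite expr1n sumr_const_seq.
  rewrite -(sum_energy (fun=> 1) 1 D0 uF sF); apply: eq_bigr => t _.
  by rewrite natr1.
have S2 : \sum_(0 <= t < D) energy D (fun x => 2 * sin (angle R D x / 2)) F (t%:R + 2^-1)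
   <= D%:R * ((size F)%:R * (8 / k) ^+ 2).
  rewrite (sum_energy _ _ D0 uF sF) ler_pM2l //.
  rewrite mulr_natl -sumr_const_seq big_seq [leRHS]big_seq ler_sum // => x xF.
  rewrite -(real_normK (num_real (2 * _))) lerXn2r ?nnegrE ?divr_ge0 ?(ltW k0) //.
  rewrite normrM ger0_norm //.
  apply: (@le_trans _ _ (2 * `|angle R D x / 2|)); first by rewrite ler_pM2l ?normr_sin_le.
  rewrite /angle !normrM !normfV !(ger0_norm (ler0n _ _)) (ger0_norm (pi_ge0 R)).
  rewrite -intr_norm /k invf_div.
  have xH : `|x|%:~R <= H%:R :> R by rewrite pmulrn ler_int bF.
  have pi4 : pi <= 4 :> R by have := @pihalf_lt2 R; lra.
  have -> : 2 * (2 * pi * `|x|%:~R / D%:R / 2) = 2 * pi * `|x|%:~R / D%:R :> R.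
    by field; rewrite gt_eqF.
  rewrite mulrA ler_pM2r ?invr_gt0 // ler_pM ?mulr_ge0 ?pi_ge0 ?ler0z //.
  lra.
rewrite S0 S1 in step.
rewrite S0 in sparse; apply: (le_trans sparse).
apply: (le_trans (lerD (lexx _) step)).
have k2 : 0 < k / 2 by lra.
move: S2; rewrite -(ler_pM2l k2) => S2.
apply: (le_trans (lerD (lexx _) (lerD S2 (lexx _)))).
rewrite le_eqVlt; apply/orP; left; apply/eqP.
rewrite /k /D !natrM natrD; field.
by rewrite !gt_eqF //= ltr0n.
Qed.

End LargeSieve.

(** * Pairs congruent modulo [v], summed over [v] *)

Section CongruentPairs.
Variable R : realType.
Implicit Types (D q v M Q t : nat) (F : seq int).

Definition congr_pairs q F : R := \sum_(x <- F) \sum_(y <- F) (q %| x - y)%Z%:R.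

Lemma sum_dvdn q n : \sum_(1 <= v < n.+1 | (q %| v)%N) 1%N = (n %/ q)%N.
Proof.
elim: n => [|n IH]; first by rewrite big_nil div0n.
rewrite big_mkcond big_nat_recr //= -big_mkcond IH; case: q {IH} => [|q].
  by rewrite !divn0 dvd0n.
by rewrite divnS // addnC; case: ifP.
Qed.

(** The denominator of [t / D] in lowest terms. *)
Definition frac_denom D t := (D %/ gcdn t D)%N.

Lemma frac_denom_gt0 D t : (0 < D)%N -> (0 < frac_denom D t)%N.
Proof. by move=> D0; rewrite divn_gt0 ?gcdn_gt0 ?D0 ?orbT // dvdn_leq ?dvdn_gcdr. Qed.

Lemma dvdn_frac_denom D t v : (0 < D)%N -> (D %| t * v)%N = (frac_denom D t %| v)%N.
Proof.
move=> D0; have g0 : (0 < gcdn t D)%N by rewrite gcdn_gt0 D0 orbT.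
have DE : D = (frac_denom D t * gcdn t D)%N by rewrite divnK // dvdn_gcdr.
rewrite [in LHS](_ : t = (t %/ gcdn t D) * gcdn t D)%N; last by rewrite divnK // dvdn_gcdl.
rewrite [X in (X %| _)%N]DE mulnAC dvdn_pmul2r // Gauss_dvdr //.
rewrite /coprime -(eqn_pmul2r g0) mul1n muln_gcdl -DE divnK ?dvdn_gcdl //.
by rewrite gcdnC.
Qed.

(** There are at most [4 M / q] multiples of [q] in the range, each with inverse at most
    [1 / (2 M)]. *)
Lemma sum_inv_multiples_le M q : (0 < M)%N -> (0 < q)%N ->
  \sum_(2 * M <= v < 4 * M | (q %| v)%N) v%:R^-1 <= (q < 4 * M)%N%:R * (2 / q%:R) :> R.
Proof.
move=> M0 q0; have MR : 0 < M%:R :> R by rewrite ltr0n.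
have qR : 0 < q%:R :> R by rewrite ltr0n.
have [qM|qM] := ltnP q (4 * M); last first.
  rewrite mul0r big_nat_cond big1 // => v /andP[/andP[v1 v2] qv].
  by have := dvdn_leq _ qv; lia.
rewrite mul1r.
apply: (@le_trans _ _ (\sum_(2 * M <= v < 4 * M | (q %| v)%N) (2 * M%:R)^-1)).
  rewrite big_nat_cond [leRHS]big_nat_cond ler_sum // => v /andP[/andP[v1 v2] _].
  by rewrite lef_pV2 ?posrE ?mulr_gt0 ?ltr0n //; [rewrite -natrM ler_nat|lia].
apply: (@le_trans _ _ ((\sum_(1 <= v < (4 * M).+1 | (q %| v)%N) 1)%N%:R * (2 * M%:R)^-1)).
  rewrite natr_sum big_distrl /= [leRHS](big_cat_nat (n := (2 * M)%N)) //=; try lia.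
  rewrite [X in _ + X](big_cat_nat (n := (4 * M)%N)) //=; try lia.
  under [X in _ <= _ + (X + _)]eq_bigr do rewrite mul1r.
  by rewrite addrCA lerDl addr_ge0 // sumr_ge0 // => v _; rewrite ?mul1r invr_ge0 mulr_ge0.
rewrite sum_dvdn ler_pdivrMr ?mulr_gt0 // mulrAC ler_pdivlMr //.
by rewrite -!natrM ler_nat; have := leq_trunc_div (4 * M) q; lia.
Qed.

(** Distinct fractions with denominators [q, q' < 4 M] differ by at least [1 / (q q')], which
    exceeds [1 / (16 M^2) = w / D], the length of a window. *)
Lemma fractions_sparse M j t t' :
  let w := ((4 * M)`!)%N in let D := (16 * M ^ 2 * w)%N in (0 < M)%N ->
  (j * w <= t < j * w + w)%N -> (j * w <= t' < j * w + w)%N ->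
  (frac_denom D t < 4 * M)%N -> (frac_denom D t' < 4 * M)%N -> t = t'.
Proof.
move=> w D M0; have w0 : (0 < w)%N by rewrite fact_gt0.
have D0 : (0 < D)%N by rewrite !muln_gt0 ?expn_gt0 ?M0 ?w0.
wlog tt' : t t' / (t <= t')%N => [hw tj tj' q1 q2|].
  have [le|/ltnW le] := leqP t t'; first exact: hw.
  by apply/esym/hw.
move=> /andP[t1 t2] /andP[t1' t2'] q1 q2; apply/eqP; rewrite eqn_leq tt' leqNgt.
apply/negP => lt; set q := frac_denom D t; set q' := frac_denom D t'.
have q0 := frac_denom_gt0 t D0; have q0' := frac_denom_gt0 t' D0.
have d1 : (D %| t * (q * q'))%N by rewrite dvdn_frac_denom // dvdn_mulr.
have d2 : (D %| t' * (q * q'))%N by rewrite dvdn_frac_denom // dvdn_mull.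
have /dvdn_leq : (D %| (t' - t) * (q * q'))%N by rewrite mulnBl dvdn_sub.
rewrite !muln_gt0 subn_gt0 lt q0 q0' => /(_ isT); apply/negP; rewrite -ltnNge.
have -> : D = (w * (4 * M * (4 * M)))%N by rewrite /D; lia.
apply: (@leq_trans (w * (q * q'))).
  by rewrite ltn_pmul2r ?muln_gt0 ?q0 ?q0' // ltn_subLR //; lia.
by rewrite leq_pmul2l // leq_mul // ltnW.
Qed.

(** After detection by characters and an exchange of sums, a frequency of denominator [q] carries
    weight at most [2 / q]. Those with [q <= Q] are reassembled into congruences modulo numbers up
    to [Q]; the others have weight at most [2 / Q] and go to the large sieve. *)
Lemma sum_congr_pairs_le M Q F : (0 < M)%N -> (0 < Q)%N -> uniq F ->
  {in F, forall x, `|x| <= (M ^ 2)%N%:Z} ->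
  \sum_(2 * M <= v < 4 * M) congr_pairs v F <=
  2 * \sum_(1 <= q < 4 * M | (q <= Q)%N) congr_pairs q F +
  2 / Q%:R * ((50 * M ^ 2)%:R * (size F)%:R).
Proof.
(* The factorial makes every modulus [v <= 4 * M] divide [D], so all the frequencies needed have the
   form [t / D]. *)
move=> M0 Q0 uF bF; set w := ((4 * M)`!)%N; set D := (16 * M ^ 2 * w)%N.
have w0 : (0 < w)%N by rewrite fact_gt0.
have M20 : (0 < M ^ 2)%N by rewrite expn_gt0 M0.
have D0 : (0 < D)%N by rewrite !muln_gt0 ?M20 ?M0 ?w0.
have QR : 0 < Q%:R :> R by rewrite ltr0n.
pose e t : R := energy D (fun=> 1) F t%:R; pose q := frac_denom D.
have e0 t : 0 <= e t by exact: energy_ge0.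
have cpE v : (0 < v < (4 * M).+1)%N ->
    congr_pairs v F = v%:R^-1 * \sum_(0 <= t < D | (q t %| v)%N) e t.
  move=> /andP[v0 vM]; have vD : (v %| D)%N by rewrite dvdn_mull // dvdn_fact // v0.
  rewrite (eq_bigl (fun t => (D %| t * v)%N)) => [|t]; last by rewrite dvdn_frac_denom.
  by rewrite (sum_energy_dvd R F D0 v0 vD) mulKf // pnatr_eq0 -lt0n.
have -> : \sum_(2 * M <= v < 4 * M) congr_pairs v F =
    \sum_(0 <= t < D) e t * \sum_(2 * M <= v < 4 * M | (q t %| v)%N) v%:R^-1.
  rewrite (eq_big_nat _ _ (F2 := fun v => \sum_(0 <= t < D | (q t %| v)%N) e t * v%:R^-1)).
    rewrite (exchange_big_dep xpredT) //=; apply: eq_bigr => t _.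
    by rewrite big_distrr.
  move=> v vM; rewrite cpE; last by lia.
  by rewrite mulrC big_distrl.
(* The weight of [e t] in the sum of [congr_pairs q' F] over [q' <= Q]. When [q t <= Q], its term
   [q' = q t] alone gives [1 / q t]. *)
pose small t := \sum_(1 <= q' < 4 * M | (q' <= Q)%N) (q t %| q')%N%:R / q'%:R : R.
apply: (@le_trans _ _ (\sum_(0 <= t < D) (2 * (e t * small t) +
    2 / Q%:R * ((q t < 4 * M)%N%:R * e t)))).
  apply: ler_sum => t _; have qt := frac_denom_gt0 t D0.
  apply: (le_trans (ler_wpM2l (e0 t) (sum_inv_multiples_le M0 qt))).
  have s0 : 0 <= small t by rewrite sumr_ge0 // => a _; rewrite mulr_ge0 // invr_ge0.
  have [qM|qM] := ltnP (frac_denom D t) (4 * M); last first.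
    by rewrite mul0r mulr0 addr_ge0 // ?mulr_ge0 // ?mulr_ge0 // invr_ge0.
  rewrite mul1r; have [qQ|qQ] := leqP (frac_denom D t) Q.
    apply: (@le_trans _ _ (2 * (e t * small t))); last first.
      by rewrite lerDl !mulr_ge0 // invr_ge0.
    rewrite mulrCA ler_pM2l // ler_wpM2l // /small.
    rewrite big_mkcond (bigD1_seq (q t)) /= ?mem_index_iota ?iota_uniq //; last first.
      by rewrite qt.
    rewrite qQ dvdnn mul1r lerDl sumr_ge0 // => a _; case: ifP => // _.
  rewrite mul1r mulrC -[leLHS]add0r lerD //; first by rewrite !mulr_ge0.
  by rewrite ler_wpM2r // ler_pM2l // lef_pV2 ?posrE ?ltr0n // ler_nat ltnW.
rewrite big_split /= -!big_distrr /= lerD //.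
  rewrite ler_pM2l // /small; under eq_bigr do rewrite big_distrr /=.
  rewrite exchange_big /= big_nat_cond [leRHS]big_nat_cond ler_sum // => v /andP[vM _].
  rewrite cpE; last by lia.
  rewrite big_distrr /= [leRHS]big_mkcond ler_sum // => t _.
  by case: ifP => _; rewrite ?mul1r ?mul0r ?mulr0 // mulrC.
rewrite ler_pM2l ?divr_gt0 //.
(* With [16 M^2] windows and radius [M^2], the sieve constant is [16 M^2 + 34 M^2 = 50 M^2]. *)
have := @large_sieve R (16 * M ^ 2) w (M ^ 2) F (fun t => frac_denom D t < 4 * M)%N.
rewrite -/D (_ : 16 * M ^ 2 + 34 * M ^ 2 = 50 * M ^ 2)%N; last by lia.
move=> ls; apply: le_trans (ls _ _ _ _ _ _ _) => //; last 3 first.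
- by rewrite !muln_gt0 ?M20 ?M0.
- by rewrite -muln2; apply: (@leq_trans (16 * M ^ 2 * 1)); [lia|rewrite leq_pmul2l //; lia].
- by move=> j t t' *; apply: (@fractions_sparse M j t t').
by rewrite [leRHS]big_mkcond ler_sum // => t _; case: ifP; rewrite ?mul1r ?mul0r.
Qed.

End CongruentPairs.

(** * Moments of the truncated divisor function *)

Section DivisorMoments.
Variable R : realType.
Implicit Types (Q X n m q e k : nat).

Definition small_divisors Q n : nat := \sum_(1 <= q < Q.+1 | (q %| n)%N) 1%N.
Local Notation d := small_divisors.

(* A divisor [q] of [e * m] is determined by [gcdn q e] and [q %/ gcdn q e]. *)
Lemma small_divisorsM Q e m : (0 < e)%N -> (0 < m)%N -> (d Q (e * m) <= d Q e * d Q m)%N.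
Proof.
move=> e0 m0; pose s n := [seq q <- index_iota 1 Q.+1 | (q %| n)%N].
have dE n : d Q n = size (s n) by rewrite /d sum1_count size_filter.
rewrite !dE -(size_allpairs pair).
pose f q := (gcdn q e, q %/ gcdn q e)%N; rewrite -(size_map f); apply: uniq_leq_size.
  rewrite map_inj_in_uniq ?filter_uniq ?iota_uniq // => q q' _ _ [g1 g2].
  by rewrite -(divnK (dvdn_gcdl q e)) g2 g1 divnK // dvdn_gcdl.
move=> z /mapP[q]; rewrite mem_filter mem_index_iota => /andP[qem /andP[q0 qQ]] ->.
have g0 : (0 < gcdn q e)%N by rewrite gcdn_gt0 q0.
have gq : (gcdn q e <= q)%N by rewrite dvdn_leq // dvdn_gcdl.
apply: allpairs_f; rewrite mem_filter mem_index_iota.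
  by rewrite dvdn_gcdr g0 (leq_ltn_trans gq).
rewrite divn_gt0 // gq (leq_ltn_trans (leq_div _ _)) // !andbT.
rewrite -(@Gauss_dvdr _ (e %/ gcdn q e)); last first.
  rewrite /coprime -(eqn_pmul2r g0) mul1n muln_gcdl !divnK ?dvdn_gcdl ?dvdn_gcdr //.
rewrite -(dvdn_pmul2r g0) divnK ?dvdn_gcdl // mulnAC divnK ?dvdn_gcdr //.
Qed.

Lemma sum_multiples_le X q (G : nat -> R) : (0 < q)%N ->
  \sum_(1 <= n < X.+1 | (q %| n)%N) G n = \sum_(1 <= m < (X %/ q).+1) G (q * m)%N.
Proof.
move=> q0; elim: X => [|X IH]; first by rewrite div0n !big_nil.
rewrite big_mkcond big_nat_recr //= -big_mkcond IH divnS //.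
have [/dvdnP[k kE]|_] := boolP (q %| X.+1)%N; last by rewrite addr0.
rewrite /= add1n [RHS]big_nat_recr //=; congr (_ + G _).
have := divnS X q0; rewrite kE dvdn_mull // mulnK // => {1}->.
by rewrite mulnC.
Qed.

Lemma natr_small_divisors Q n : (d Q n)%:R = \sum_(1 <= q < Q.+1 | (q %| n)%N) 1 :> R.
Proof. by rewrite natr_sum. Qed.

(** Open one of the [k + 1] factors as a sum over [q %| n], write [n = q * m], and separate [q] from
    [m] by submultiplicativity; the sum over [m <= X / q] is a [k]-th moment. *)
Lemma small_divisors_moment_rec k Q X (A : R) :
  (forall Y, \sum_(1 <= n < Y.+1) (d Q n)%:R ^+ k <= Y%:R * A) ->
  \sum_(1 <= n < X.+1) (d Q n)%:R ^+ k.+1 <=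
  X%:R * (A * \sum_(1 <= q < Q.+1) (d Q q)%:R ^+ k / q%:R).
Proof.
move=> IH; have A0 : 0 <= A.
  by have := IH 1%N; rewrite mul1r; apply: le_trans; rewrite sumr_ge0.
under eq_bigr do rewrite exprS [X in X * _]natr_small_divisors big_distrl /=.
rewrite (exchange_big_dep xpredT) //= mulrA big_distrr /=.
rewrite big_nat_cond [leRHS]big_nat_cond ler_sum // => q /andP[/andP[q0 qQ] _].
have qR : 0 < q%:R :> R by rewrite ltr0n.
rewrite sum_multiples_le //.
apply: (@le_trans _ _ ((d Q q)%:R ^+ k * \sum_(1 <= m < (X %/ q).+1) (d Q m)%:R ^+ k)).
  rewrite big_distrr /= big_nat_cond [leRHS]big_nat_cond ler_sum //= => m /andP[/andP[m0 _] _].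
  rewrite mul1r -exprMn -natrM; apply: lerXn2r; rewrite ?nnegrE // ler_nat.
  exact: small_divisorsM.
rewrite mulrCA ler_wpM2l ?exprn_ge0 //.
apply: (le_trans (IH _)); rewrite mulrAC ler_wpM2r //.
by rewrite ler_pdivlMr // -natrM ler_nat leq_trunc_div.
Qed.

(** The same opening of one factor, with [n = a * b] and [1 / n = (1 / a) (1 / b)]; letting [b] run
    up to [Q] instead of [Q / a] completes the square. *)
Lemma small_divisors_weight_rec k Q :
  \sum_(1 <= q < Q.+1) (d Q q)%:R ^+ k.+1 / q%:R <=
  (\sum_(1 <= q < Q.+1) (d Q q)%:R ^+ k / q%:R) ^+ 2 :> R.
Proof.
rewrite expr2 big_distrl /=.
under eq_bigr do rewrite exprS -mulrA [X in X * _]natr_small_divisors big_distrl /=.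
rewrite (exchange_big_dep xpredT) //=.
rewrite big_nat_cond [leRHS]big_nat_cond ler_sum // => a /andP[/andP[a0 aQ] _].
rewrite (sum_multiples_le Q (fun n => 1 * ((d Q n)%:R ^+ k / n%:R))) // big_distrr /=.
have QaQ : (Q %/ a <= Q)%N by rewrite leq_div.
rewrite [leRHS](big_cat_nat (n := (Q %/ a).+1)) //= -[leLHS]addr0 lerD //; last first.
  by rewrite sumr_ge0 // => b _; rewrite !mulr_ge0 ?exprn_ge0 ?invr_ge0.
rewrite big_nat_cond [leRHS]big_nat_cond ler_sum // => b /andP[/andP[b0 _] _].
rewrite mul1r mulrACA -invfM -natrM ler_wpM2r ?invr_ge0 //.
rewrite -exprMn -natrM; apply: lerXn2r; rewrite ?nnegrE // ler_nat.
exact: small_divisorsM.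
Qed.

(** Repeated squaring bounds the [k]-th weighted sum by [L ^+ (2 ^ k)]. The [k]-th moment
    accumulates the exponent [1 + 2 + ... + 2^(k-1) = 2^k - 1], which is [15] for [k = 4]. *)
Lemma small_divisors_moment4 Q X :
  \sum_(1 <= n < X.+1) (d Q n)%:R ^+ 4 <=
  X%:R * (\sum_(1 <= q < Q.+1) q%:R^-1) ^+ 15 :> R.
Proof.
set L := \sum_(1 <= q < Q.+1) _.
have L0 : 0 <= L by rewrite sumr_ge0 // => q _; rewrite invr_ge0.
pose B k := \sum_(1 <= q < Q.+1) (d Q q)%:R ^+ k / q%:R : R.
have B0 k : 0 <= B k by rewrite sumr_ge0 // => q _; rewrite mulr_ge0 ?exprn_ge0 ?invr_ge0.
have BL k : B k <= L ^+ (2 ^ k).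
  elim: k => [|k IH]; first by rewrite /B /L; under eq_bigr do rewrite expr0 mul1r.
  apply: (le_trans (small_divisors_weight_rec k Q)).
  by rewrite -/(B k) expnSr exprM lerXn2r ?nnegrE ?exprn_ge0.
have M k : forall X, \sum_(1 <= n < X.+1) (d Q n)%:R ^+ k <= X%:R * L ^+ (2 ^ k).-1.
  elim: k => [|k IH] Y.
    by under eq_bigr do rewrite expr0; rewrite sumr_const_nat subn1 mulr1.
  apply: (le_trans (small_divisors_moment_rec Y IH)); rewrite ler_wpM2l // -/(B k).
  rewrite (_ : (2 ^ k.+1).-1 = (2 ^ k).-1 + 2 ^ k)%N; last first.
    have p0 : (0 < 2 ^ k)%N by rewrite expn_gt0.
    by rewrite expnS; lia.
  by rewrite exprD ler_wpM2l ?exprn_ge0.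
exact: (M 4).
Qed.

Lemma harmonic_pow2_le i : \sum_(1 <= q < (2 ^ i).+1) q%:R^-1 <= i.+1%:R :> R.
Proof.
elim: i => [|i IH]; first by rewrite big_nat1 invr1.
have p0 : (0 < 2 ^ i)%N by rewrite expn_gt0.
rewrite (big_cat_nat (n := (2 ^ i).+1)) //=; last by rewrite ltnS leq_pexp2l.
rewrite -natr1 lerD //.
apply: (@le_trans _ _ (\sum_((2 ^ i).+1 <= q < (2 ^ i.+1).+1) (2 ^ i)%:R^-1)).
  rewrite ler_sum_nat // => q /andP[q1 _].
  by rewrite lef_pV2 ?posrE ?ltr0n ?ler_nat //; lia.
by rewrite sumr_const_nat expnS subSS mul2n -addnn addnK -[leLHS]mulr_natl mulfV //.
Qed.

End DivisorMoments.

(** * Congruent pairs inside a window of length [M^2] *)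

Section CongruentPairsBound.
Variable R : realType.
Implicit Types (M Q n j q : nat) (F : seq int).
Local Notation d := small_divisors.

Lemma ler_sum_subset (I : eqType) (s r : seq I) (G : I -> R) : uniq s -> uniq r ->
  {subset s <= r} -> {in r, forall i, 0 <= G i} -> \sum_(i <- s) G i <= \sum_(i <- r) G i.
Proof.
move=> us ur sr G0.
rewrite (perm_big [seq i <- r | i \in s]) /=; last first.
  apply: uniq_perm; rewrite ?filter_uniq // => i; rewrite mem_filter.
  by case si : (i \in s) => //; rewrite (sr _ si).
rewrite big_filter big_mkcond big_seq [leRHS]big_seq ler_sum // => i ir.
by case: ifP => // _; rewrite G0.
Qed.

(** With [j = 15 a + r] and [r < 15], one has [2 j + 1 <= 30 (a + 1) <= 30 * 2^a] and [15 a <= j].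
    This is how the logarithmic powers are absorbed. *)
Lemma poly_le_exp j : (2 * j + 1)%:R ^+ 15 <= 30 ^+ 15 * 2 ^+ j :> R.
Proof.
have jE := divn_eq j 15; have jm : (j %% 15 < 15)%N by rewrite ltn_mod.
set a := (j %/ 15)%N in jE.
have exp_ge i : i.+1%:R <= 2 ^+ i :> R.
  by rewrite -natrX ler_nat ltn_expl.
apply: (@le_trans _ _ ((30 * a.+1%:R) ^+ 15)).
  apply: lerXn2r; rewrite ?nnegrE ?mulr_ge0 //.
  by rewrite -[30]/(30%:R) -natrM ler_nat; lia.
rewrite exprMn ler_wpM2l ?exprn_ge0 //.
apply: (@le_trans _ _ ((2 ^+ a) ^+ 15)).
  by apply: lerXn2r; rewrite ?nnegrE ?exprn_ge0.
by rewrite -exprM ler_weXn2l ?ler1n //; lia.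
Qed.

Lemma pow2_cube j : (2 ^+ j) ^+ 3 = (8 ^ j)%:R :> R.
Proof. by rewrite -exprM mulnC exprM natrX; congr (_ ^+ _); ring. Qed.

(** On each side of [x] the distance determines [y], hence the factor [2]. *)
Lemma sum_dist_le (X : nat) F (x : int) (G : nat -> R) : uniq F ->
  (forall m, 0 <= G m) -> {in F, forall y, `|x - y| <= X%:Z} ->
  \sum_(y <- F | y != x) G `|x - y|%N <= 2 * \sum_(1 <= m < X.+1) G m.
Proof.
move=> uF G0 bF.
have half (P : pred int) : {in F &, forall y z, P y -> P z -> `|x - y|%N = `|x - z|%N -> y = z} ->
    (forall y, P y -> y != x) ->
    \sum_(y <- F | P y) G `|x - y|%N <= \sum_(1 <= m < X.+1) G m.
  move=> iP nP; rewrite -big_filter -(big_map (fun y => `|x - y|%N) xpredT).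
  apply: ler_sum_subset => //; rewrite ?iota_uniq //.
    rewrite map_inj_in_uniq ?filter_uniq // => y z; rewrite !mem_filter.
    by move=> /andP[Py yF] /andP[Pz zF]; exact: iP.
  move=> m /mapP[y]; rewrite mem_filter mem_index_iota => /andP[/nP yx /bF xy] ->.
  by lia.
rewrite (bigID (fun y => y < x)) /= mulr_natl mulr2n lerD //; apply: half.
- by move=> y z _ _; lia.
- by move=> y; lia.
- by move=> y z _ _; lia.
by move=> y; lia.
Qed.

(** With [t = 2 ^+ j], [M^2] is comparable to [|F| t^3]. The inequality [a <= t + a^4 / t^3] reduces
    matters to the fourth moment over all distances up to [M^2], at most [M^2 (2 j + 1)^15]; after
    division by [t^3] one factor [t] is to spare, and it absorbs the power of [2 j + 1]. *)
Lemma sum_small_divisors_dist_le M j F x : uniq F -> (size F * 8 ^ j <= M ^ 2)%N ->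
  (M ^ 2 < size F * 8 ^ j.+1)%N -> {in F, forall y, `|x - y| <= (M ^ 2)%N%:Z} ->
  \sum_(y <- F | y != x) (d (4 ^ j) `|x - y|%N)%:R <=
  (1 + 16 * 30 ^+ 15) * ((size F)%:R * 2 ^+ j) :> R.
Proof.
move=> uF Mlo Mhi bF; set t : R := 2 ^+ j; set n : R := (size F)%:R.
have t0 : 0 < t by rewrite exprn_gt0.
have n0 : 0 <= n by rewrite ler0n.
have split_le (a : R) : 0 <= a -> a <= t + a ^+ 4 / t ^+ 3.
  move=> a0; have [at_|ta] := leP a t.
    by rewrite -[leLHS]addr0 lerD // divr_ge0 ?exprn_ge0 // ltW.
  apply: (@le_trans _ _ (a ^+ 4 / t ^+ 3)); last by rewrite lerDr ltW.
  rewrite ler_pdivlMr ?exprn_gt0 // [a ^+ 4]exprS ler_wpM2l //.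
  by apply: lerXn2r; rewrite ?nnegrE //; exact: ltW.
apply: (@le_trans _ _ (\sum_(y <- F | y != x) (t + (d (4 ^ j) `|x - y|%N)%:R ^+ 4 / t ^+ 3))).
  by apply: ler_sum => y _; apply: split_le.
rewrite big_split /= -big_distrl /= mulrDl mul1r lerD //.
  apply: (@le_trans _ _ (\sum_(y <- F) t)); last by rewrite sumr_const_seq mulr_natl.
  by rewrite big_mkcond ler_sum // => y _; case: ifP => // _; exact: ltW.
rewrite ler_pdivrMr ?exprn_gt0 //.
apply: (le_trans (sum_dist_le (G := fun m => (d (4 ^ j) m)%:R ^+ 4) uF _ bF)).
  by move=> m; rewrite exprn_ge0.
rewrite -mulrA -mulrA (_ : 16 = 2 * 8); last by ring.
rewrite -mulrA ler_pM2l //.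
apply: (le_trans (small_divisors_moment4 R _ _)).
set L := \sum_(1 <= q < _) _.
have L0 : 0 <= L by rewrite sumr_ge0 // => q _; rewrite invr_ge0.
have LK : L ^+ 15 <= 30 ^+ 15 * t.
  apply: le_trans (poly_le_exp j); apply: lerXn2r; rewrite ?nnegrE //.
  by rewrite addn1 /L (_ : 4 ^ j = 2 ^ (2 * j))%N ?harmonic_pow2_le // expnM.
have Mn : (M ^ 2)%:R <= 8 * (n * t ^+ 3).
  by rewrite /n /t pow2_cube -[8]/(8%:R) -!natrM ler_nat mulnCA -expnS ltnW.
apply: (@le_trans _ _ (8 * (n * t ^+ 3) * (30 ^+ 15 * t))).
  by rewrite ler_pM // exprn_ge0.
by rewrite le_eqVlt; apply/orP; left; apply/eqP; ring.
Qed.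

(** Twice the constant [1 + 16 * 30 ^+ 15] of the small denominators, plus [800] from the large
    sieve. *)
Definition congr_const : R := 802 + 32 * 30 ^+ 15.

(** The choice [Q = 4^j] balances the two parts: as [M^2 < 8 |F| 8^j], the large sieve term
    [M^2 |F| / Q] is of order [|F|^2 2^j], like the off-diagonal pairs weighted by their divisors up
    to [Q]. The diagonal pairs give [M |F|]. *)
Lemma sum_congr_pairs_window M j F (x0 : int) : (0 < M)%N -> uniq F ->
  (size F * 8 ^ j <= M ^ 2)%N -> (M ^ 2 < size F * 8 ^ j.+1)%N ->
  {in F, forall x, x0 <= x < x0 + (M ^ 2)%N%:Z} ->
  \sum_(2 * M <= v < 4 * M) congr_pairs R v F <=
  congr_const * (M%:R * (size F)%:R + (size F)%:R ^+ 2 * 2 ^+ j).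
Proof.
move=> M0 uF Mlo Mhi bF; set Q := (4 ^ j)%N; set n : R := (size F)%:R.
have Q0 : (0 < Q)%N by rewrite expn_gt0.
have QE : Q%:R = 2 ^+ j * 2 ^+ j :> R by rewrite -exprMn /Q natrX; congr (_ ^+ _); ring.
have t0 : 0 < 2 ^+ j :> R by rewrite exprn_gt0.
have n0 : 0 <= n by rewrite ler0n.
have MR : 0 < M%:R :> R by rewrite ltr0n.
(* Translation preserves congruences and moves [F] into the range [|x| <= M^2] of the sieve. *)
pose F0 := [seq x - x0 | x <- F].
have cpE v : congr_pairs R v F0 = congr_pairs R v F.
  rewrite /congr_pairs big_map; apply: eq_bigr => x _; rewrite big_map.
  by apply: eq_bigr => y _; rewrite opprB addrA subrK.
have := @sum_congr_pairs_le R M Q F0 M0 Q0.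
rewrite map_inj_uniq; last exact: addIr.
move=> /(_ uF) H; have {}H := H _.
rewrite size_map -/n in H; under eq_bigr do rewrite -cpE.
apply: (le_trans (H _)); first by move=> z /mapP[x /bF] + ->; lia.
under eq_bigr do rewrite cpE.
have small : \sum_(1 <= q < 4 * M | (q <= Q)%N) congr_pairs R q F <=
    4 * M%:R * n + n * ((1 + 16 * 30 ^+ 15) * (n * 2 ^+ j)).
  rewrite /congr_pairs exchange_big /=.
  apply: (@le_trans _ _ (\sum_(x <- F) (4 * M%:R + (1 + 16 * 30 ^+ 15) * (n * 2 ^+ j)))).
    rewrite big_seq [leRHS]big_seq ler_sum // => x xF.
    rewrite exchange_big /= (bigD1_seq x) //= lerD //.
      under eq_bigr do rewrite subrr dvdz0.
      apply: (@le_trans _ _ (\sum_(1 <= q < 4 * M) 1)).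
        by rewrite big_mkcond ler_sum // => q _; case: ifP.
      by rewrite sumr_const_nat -[4]/(4%:R) -natrM ler_nat; lia.
    have bx : {in F, forall y, `|x - y| <= (M ^ 2)%N%:Z}.
      by move=> y /bF; move/bF: xF; lia.
    apply: le_trans (sum_small_divisors_dist_le uF Mlo Mhi bx).
    apply: ler_sum => y yx; rewrite natr_small_divisors.
    rewrite big_mkcond /=.
    rewrite [leRHS](_ : _ = \sum_(1 <= q < Q.+1) (q %| x - y)%Z%:R); last first.
      by rewrite big_mkcond; apply: eq_bigr => q _; rewrite dvdzE /=; case: ifP.
    rewrite -big_mkcond -big_filter; apply: ler_sum_subset => //.
    - by rewrite filter_uniq // iota_uniq.
    - by rewrite iota_uniq.
    by move=> q; rewrite mem_filter !mem_index_iota; lia.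
  by rewrite sumr_const_seq -[leLHS]mulr_natl -/n mulrDr [n * (4 * _)]mulrC.
have large : 2 / Q%:R * ((50 * M ^ 2)%:R * n) <= 800 * (n ^+ 2 * 2 ^+ j).
  have Mn : (M ^ 2)%:R <= 8 * (n * (2 ^+ j) ^+ 3).
    by rewrite /n pow2_cube -[8]/(8%:R) -!natrM ler_nat mulnCA -expnS ltnW.
  rewrite QE natrM mulrAC ler_pdivrMr ?mulr_gt0 //.
  apply: (@le_trans _ _ (2 * (50 * (8 * (n * (2 ^+ j) ^+ 3)) * n))).
    by rewrite ler_pM2l // ler_wpM2r // ler_pM2l.
  by rewrite le_eqVlt; apply/orP; left; apply/eqP; ring.
apply: (le_trans (lerD (ler_wpM2l _ small) large)) => //.
rewrite /congr_const -subr_ge0; set K := 30 ^+ 15.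
have K0 : 0 <= K by rewrite exprn_ge0.
rewrite [X in 0 <= X](_ : _ = (794 + 32 * K) * (M%:R * n)); last by ring.
by rewrite mulr_ge0 ?addr_ge0 ?mulr_ge0 // ltW.
Qed.

End CongruentPairsBound.

(** * Edges of the graph of squares between two windows *)

Section SquareGraph.
Variable R : realType.
Implicit Types (a b k M N : nat) (F G : seq int) (x y : int).

Definition sq_in a b (z : int) : bool :=
  has (fun k : nat => z == (k ^ 2)%N%:Z) (index_iota a b).

Lemma sq_inP a b z :
  reflect (exists2 k, (a <= k < b)%N & z = (k ^ 2)%N%:Z) (sq_in a b z).
Proof.
apply: (iffP hasP) => [[k]|[k kab ->]]; last by exists k; rewrite ?mem_index_iota.
by rewrite mem_index_iota => kab /eqP ->; exists k.
Qed.

Definition sq_edges a b F G : R :=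
  \sum_(x <- F) \sum_(y <- G) (sq_in a b (y - x))%:R.

Lemma sq_edges_ge0 a b F G : 0 <= sq_edges a b F G.
Proof. by rewrite sumr_ge0 // => x _; rewrite sumr_ge0. Qed.

Lemma sq_edges_le a b F G : sq_edges a b F G <= (size F)%:R * (size G)%:R.
Proof.
rewrite mulr_natl -sumr_const_seq ler_sum // => x _.
by rewrite -sumr_const_seq ler_sum // => y _; case: (sq_in _ _ _).
Qed.

Lemma sq_edges_opp a b F G :
  sq_edges a b F G = sq_edges a b [seq - y | y <- G] [seq - x | x <- F].
Proof.
rewrite /sq_edges exchange_big /= big_map; apply: eq_bigr => y _.
by rewrite big_map; apply: eq_bigr => x _; rewrite opprK addrC.
Qed.

Lemma sqr_sum_le (s : seq int) (h : int -> R) :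
  (\sum_(y <- s) h y) ^+ 2 <= (size s)%:R * \sum_(y <- s) h y ^+ 2.
Proof.
rewrite expr2 big_distrlr /=.
apply: (@le_trans _ _ (\sum_(y <- s) \sum_(z <- s) (h y ^+ 2 / 2 + h z ^+ 2 / 2))).
  apply: ler_sum => y _; apply: ler_sum => z _.
  by have := sqr_ge0 (h y - h z); nra.
rewrite [leLHS](eq_bigr (fun y => h y ^+ 2 / 2 *+ size s + \sum_(z <- s) h z ^+ 2 / 2)) => [|y _].
  rewrite big_split /= sumr_const_seq sumrMnl -mulrnDl -big_split /= -[leLHS]mulr_natl.
  by rewrite ler_wpM2l // ler_sum // => y _; rewrite -splitr.
by rewrite big_split /= sumr_const_seq.
Qed.

(* If [y = x + k^2 = x' + l^2] then [v = k + l] divides [x - x'] and determines [y],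
   since [k - l = (x' - x) / v]. *)
Lemma common_squares_le M G x x' : (0 < M)%N -> uniq G ->
  \sum_(y <- G) (sq_in M (2 * M) (y - x))%:R * (sq_in M (2 * M) (y - x'))%:R <=
  \sum_(2 * M <= v < 4 * M) (v %| x - x')%Z%:R :> R.
Proof.
move=> M0 uG.
pose A := [seq y <- G | sq_in M (2 * M) (y - x) && sq_in M (2 * M) (y - x')].
pose V := [seq v : nat <- index_iota (2 * M) (4 * M) | (v %| x - x')%Z].
have -> : \sum_(y <- G) (sq_in M (2 * M) (y - x))%:R * (sq_in M (2 * M) (y - x'))%:R =
    (size A)%:R :> R.
  rewrite size_filter -sum1_count natr_sum [RHS]big_mkcond; apply: eq_bigr => y _.
  by case: (sq_in _ _ _) (sq_in _ _ _) => [] []; rewrite ?mulr0 ?mul0r ?mulr1.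
have -> : \sum_(2 * M <= v < 4 * M) (v %| x - x')%Z%:R = (size V)%:R :> R.
  by rewrite size_filter -sum1_count natr_sum [RHS]big_mkcond; apply: eq_bigr => v _; case: ifP.
pose h (v : nat) := x + (((v%:Z + ((x' - x) %/ v)%Z) %/ 2)%Z) ^+ 2.
rewrite ler_nat -(size_map h); apply: uniq_leq_size; first exact: filter_uniq.
move=> y; rewrite mem_filter => /andP[/andP[/sq_inP[k kM yx] /sq_inP[l lM yx']] _].
have xx : x' - x = (k%:Z - l%:Z) * (k + l)%N%:Z.
  have -> : x' - x = (y - x) - (y - x') by ring.
  by rewrite yx yx' PoszD; lia.
have v0 : (k + l)%N%:Z != 0 by lia.
apply/mapP; exists (k + l)%N.
  rewrite mem_filter mem_index_iota -opprB rpredN xx dvdz_mull //=; lia.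
rewrite /h xx mulzK //.
have -> : (k + l)%N%:Z + (k%:Z - l%:Z) = k%:Z * 2 by lia.
by rewrite mulzK // -[y](subrK x) yx; lia.
Qed.

(** Cauchy-Schwarz over [y] in [G]: the expanded square counts the common neighbours of pairs
    [x, x'] of [F]. *)
Lemma sqr_sq_edges_le M F G : (0 < M)%N -> uniq G ->
  sq_edges M (2 * M) F G ^+ 2 <=
  (size G)%:R * \sum_(2 * M <= v < 4 * M) congr_pairs R v F.
Proof.
move=> M0 uG; rewrite /sq_edges exchange_big /=.
apply: (le_trans (sqr_sum_le _ _)); rewrite ler_wpM2l //.
rewrite (eq_bigr (fun y => \sum_(x <- F) \sum_(x' <- F)
    (sq_in M (2 * M) (y - x))%:R * (sq_in M (2 * M) (y - x'))%:R)) => [|y _]; last first.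
  by rewrite expr2 big_distrlr.
rewrite [leLHS]exchange_big /= /congr_pairs [leRHS]exchange_big /=; apply: ler_sum => x _.
rewrite [leLHS]exchange_big /= [leRHS]exchange_big /=; apply: ler_sum => x' _.
exact: common_squares_le.
Qed.

Lemma size_window (H : nat) F x0 : uniq F ->
  {in F, forall x, x0 <= x < x0 + H%:Z} -> (size F <= H)%N.
Proof.
move=> uF bF; rewrite -[H]subn0 -(size_iota 0 (H - 0)) -(size_map (fun x => `|x - x0|%N)).
apply: uniq_leq_size.
  by rewrite map_inj_in_uniq // => x y /bF + /bF; lia.
by move=> m /mapP[x /bF + ->]; rewrite mem_iota; lia.
Qed.

Local Notation C0 := (congr_const R).
(** This is [(2 * C0) ^+ 3], from cubing a bound for the square of the number of edges. *)
Definition window_const : R := 8 * C0 ^+ 3.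

Lemma congr_const_ge1 : 1 <= C0.
Proof.
have : 0 <= 30 ^+ 15 :> R by rewrite exprn_ge0.
by rewrite /congr_const; move: (30 ^+ 15) => K; lra.
Qed.

Lemma sq_edges_window_le M F G x0 : (0 < M)%N -> uniq F -> uniq G ->
  (size F <= size G)%N -> {in F, forall x, x0 <= x < x0 + (M ^ 2)%N%:Z} ->
  sq_edges M (2 * M) F G ^+ 3 <=
  window_const * M%:R * ((size F)%:R * (size G)%:R) ^+ 2.
Proof.
move=> M0 uF uG FG bF; have C1 := congr_const_ge1.
have W0 : 0 <= window_const by rewrite /window_const mulr_ge0 ?exprn_ge0; lra.
set n : R := (size F)%:R; set m : R := (size G)%:R; set B := sq_edges _ _ _ _.
have MR : 0 < M%:R :> R by rewrite ltr0n.
have n0 : 0 <= n by exact: ler0n.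
have m0 : 0 <= m by exact: ler0n.
have nm : n <= m by rewrite ler_nat.
have B0 : 0 <= B by exact: sq_edges_ge0.
have Bnm : B <= n * m by exact: sq_edges_le.
have [sF0|sF] := posnP (size F).
  have -> : B = 0 by apply/le_anti; rewrite B0 (le_trans Bnm) // /n sF0 mul0r.
  by rewrite expr0n mulr_ge0 ?sqr_ge0 // mulr_ge0 // ltW.
have FM := size_window uF bF.
have q0 : (0 < M ^ 2 %/ size F)%N by rewrite divn_gt0.
(* [j] is the integer part of the logarithm of [M^2 / |F|] to the base [8]. *)
have /andP[] := @trunc_log_bounds 8 _ isT q0.
set j := trunc_log _ _; rewrite leq_divRL // ltn_divLR // ![(8 ^ _ * _)%N]mulnC => jlo jhi.
have := sum_congr_pairs_window R M0 uF jlo jhi bF; rewrite -/n => S.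
have {S}B2 := le_trans (sqr_sq_edges_le F M0 uG) (ler_wpM2l m0 S); rewrite -/B in B2.
have t0 : 0 < 2 ^+ j :> R by rewrite exprn_gt0.
have t3 : n * (2 ^+ j) ^+ 3 <= M%:R ^+ 2.
  by rewrite pow2_cube -natrX -natrM ler_nat.
move: B2 t0 t3; move: (2 ^+ j) => t B2 t0 t3.
have C00 : 0 <= C0 by lra.
(* If the diagonal term dominates, multiply [B^2 <= 2 C0 M n m] by the trivial bound [B <= n m]. *)
have [c1|c2] := leP (n ^+ 2 * t) (M%:R * n).
  have B2' : B ^+ 2 <= 2 * C0 * M%:R * (n * m).
    apply: (le_trans B2).
    apply: (@le_trans _ _ (m * (C0 * (M%:R * n + M%:R * n)))).
      by rewrite ler_wpM2l // ler_wpM2l // lerD2l.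
    by rewrite le_eqVlt; apply/orP; left; apply/eqP; ring.
  rewrite exprSr; apply: (le_trans (ler_pM _ B0 B2' Bnm)); first exact: sqr_ge0.
  rewrite -[leLHS]mulrA -expr2 ler_wpM2r ?sqr_ge0 // ler_pM2r // /window_const.
  by rewrite exprS; have := mulr_ge0 C00 (sqr_ge0 (C0 - 1)); nra.
(* Otherwise cube the bound for [B^2]: [n t^3 <= M^2] and [n <= m] turn [m^3 n^6 t^3] into
   [(n m)^4 M^2]. *)
have B2' : B ^+ 2 <= 2 * C0 * (m * (n ^+ 2 * t)).
  apply: (le_trans B2).
  apply: (@le_trans _ _ (m * (C0 * (n ^+ 2 * t + n ^+ 2 * t)))).
    by rewrite ler_wpM2l // ler_wpM2l // lerD2r ltW.
  by rewrite le_eqVlt; apply/orP; left; apply/eqP; ring.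
rewrite -(@ler_pXn2r _ 2) ?nnegrE ?exprn_ge0 //; last first.
  by rewrite mulr_ge0 ?sqr_ge0 // mulr_ge0 // ltW.
rewrite -exprM mulnC exprM.
apply: (@le_trans _ _ ((2 * C0 * (m * (n ^+ 2 * t))) ^+ 3)).
  apply: lerXn2r; rewrite ?nnegrE ?sqr_ge0 //.
  by rewrite !mulr_ge0 ?sqr_ge0 // ltW.
have -> : (2 * C0 * (m * (n ^+ 2 * t))) ^+ 3 =
    window_const * (m ^+ 3 * n ^+ 5 * (n * t ^+ 3)) by rewrite /window_const; ring.
have -> : (window_const * M%:R * (n * m) ^+ 2) ^+ 2 =
    window_const * (window_const * (m ^+ 3 * n ^+ 4 * m * M%:R ^+ 2)) by ring.
rewrite ler_wpM2l //.
apply: (@le_trans _ _ (1 * (m ^+ 3 * n ^+ 4 * m * M%:R ^+ 2))).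
  rewrite mul1r; apply: ler_pM => //; first by rewrite mulr_ge0 ?exprn_ge0.
    by rewrite mulr_ge0 ?exprn_ge0 // ltW.
  by rewrite [n ^+ 5]exprSr mulrA ler_wpM2l // mulr_ge0 ?exprn_ge0.
rewrite ler_wpM2r //; first by rewrite !mulr_ge0 ?exprn_ge0 // ltW.
rewrite /window_const; have : 1 <= C0 ^+ 3 by rewrite exprn_ege1.
lra.
Qed.

(** The previous bound wants the smaller set on the left; the reflection [x -> -x] exchanges the two
    sides of the graph. *)
Lemma sq_edges_windows_le M F G x0 y0 : (0 < M)%N -> uniq F -> uniq G ->
  {in F, forall x, x0 <= x < x0 + (M ^ 2)%N%:Z} ->
  {in G, forall y, y0 <= y < y0 + (M ^ 2)%N%:Z} ->
  sq_edges M (2 * M) F G ^+ 3 <=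
  window_const * M%:R * ((size F)%:R * (size G)%:R) ^+ 2.
Proof.
move=> M0 uF uG bF bG; have [FG|/ltnW GF] := leqP (size F) (size G).
  exact: (sq_edges_window_le (x0 := x0)).
rewrite sq_edges_opp [(size F)%:R * _]mulrC.
rewrite -(size_map -%R G) -(size_map -%R F).
(* The [+ 1] appears because reflecting a half-open window exchanges its open and closed ends. *)
apply: (sq_edges_window_le (x0 := - (y0 + (M ^ 2)%N%:Z) + 1)) => //.
- by rewrite map_inj_uniq //; exact: oppr_inj.
- by rewrite map_inj_uniq //; exact: oppr_inj.
- by rewrite !size_map.
by move=> z /mapP[y /bG + ->]; lia.
Qed.

End SquareGraph.

(** * Edges between arbitrary finite sets *)

Section GlobalSquareGraph.
Variable R : realType.
Implicit Types (k M N : nat) (F G : seq int) (x y : int).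

Lemma ler_cube (a b : R) : 0 <= a -> 0 <= b -> a ^+ 3 <= b ^+ 3 -> a <= b.
Proof. by move=> a0 b0; rewrite ler_pXn2r. Qed.

Lemma cube_root_powR (a : R) : 0 <= a -> (a `^ 3^-1) ^+ 3 = a.
Proof.
by move=> a0; rewrite -powR_mulrn ?powR_ge0 // -powRrM mulVf // powRr1.
Qed.

Lemma partition_sum (e : int -> int) F (h : int -> R) :
  \sum_(x <- F) h x = \sum_(i <- undup (map e F)) \sum_(x <- F | e x == i) h x.
Proof.
rewrite (exchange_big_dep xpredT) //= big_seq [RHS]big_seq; apply: eq_bigr => x xF.
rewrite -big_filter (perm_big [:: e x]) ?big_seq1 //.
apply: uniq_perm; rewrite ?filter_uniq ?undup_uniq // => i.
rewrite mem_filter mem_undup inE eq_sym; case: eqP => // ->.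
by rewrite map_f.
Qed.

Lemma partition_size (e : int -> int) F :
  (size F)%:R = \sum_(i <- undup (map e F)) (size [seq x <- F | e x == i])%:R :> R.
Proof.
have := partition_sum e F (fun=> 1 : R); rewrite sumr_const_seq => ->.
by apply: eq_bigr => i _; rewrite -big_filter sumr_const_seq.
Qed.

Lemma sum_bool_le (P : pred int) (c s : seq int) : uniq s -> {subset P <= c} ->
  \sum_(i <- s) (P i)%:R <= (size c)%:R :> R.
Proof.
move=> us Pc; rewrite (_ : \sum_(i <- s) _ = (size [seq i <- s | P i])%:R).
  rewrite ler_nat uniq_leq_size ?filter_uniq // => i; rewrite mem_filter.
  by move=> /andP[Pi _]; exact: Pc.
rewrite size_filter -sum1_count natr_sum [RHS]big_mkcond.
by apply: eq_bigr => i _; case: (P i).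
Qed.

(** With [w = (u + v) / 2 <= 1], [(u v)^2 <= w^4 <= w^3]. A sum of [u] and [v], unlike their
    product, can be summed over one index at a time. *)
Lemma cube_le_mean (a s u v : R) : 0 <= a -> 0 <= s -> 0 <= u <= 1 -> 0 <= v <= 1 ->
  a ^+ 3 <= s ^+ 3 * (u * v) ^+ 2 -> a <= s * ((u + v) / 2).
Proof.
move=> a0 s0 /andP[u0 u1] /andP[v0 v1] h.
have w0 : 0 <= (u + v) / 2 by lra.
apply: ler_cube => //; first by rewrite mulr_ge0.
rewrite exprMn; apply: (le_trans h); rewrite ler_wpM2l ?exprn_ge0 //.
set w := (u + v) / 2 in w0 *; have w1 : w <= 1 by rewrite /w; lra.
apply: (@le_trans _ _ ((w ^+ 2) ^+ 2)).
  apply: lerXn2r; rewrite ?nnegrE; [exact: mulr_ge0|exact: sqr_ge0|].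
  by rewrite /w; have := sqr_ge0 (u - v); nra.
by rewrite -exprM [w ^+ (2 * 2)]exprS ler_piMl ?exprn_ge0.
Qed.

Lemma sq_edges_blocks a b (e : int -> int) F G : sq_edges R a b F G =
  \sum_(i <- undup (map e F)) \sum_(j <- undup (map e G))
    sq_edges R a b [seq x <- F | e x == i] [seq y <- G | e y == j].
Proof.
rewrite /sq_edges (partition_sum e); apply: eq_bigr => i _.
rewrite [RHS]exchange_big /= -big_filter; apply: eq_bigr => x _.
by rewrite (partition_sum e); apply: eq_bigr => j _; rewrite big_filter.
Qed.

Lemma window_const_ge0 : 0 <= window_const R.
Proof.
by have := congr_const_ge1 R => C1; rewrite /window_const mulr_ge0 ?exprn_ge0; lra.
Qed.

(** Cut the integers into windows of length [M^2], so that each window meets boundedly many others.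
    The shares [u i], [v j] of [F], [G] in the windows sum to [1], and [cube_le_mean] lets the
    window bounds add up without loss. The cube root [s] enters through its cube only. *)
Lemma sq_edges_dyadic_le M F G (s : R) : (0 < M)%N -> uniq F -> uniq G -> 0 <= s ->
  s ^+ 3 = window_const R * M%:R * ((size F)%:R * (size G)%:R) ^+ 2 ->
  sq_edges R M (2 * M) F G <= 4 * s.
Proof.
move=> M0 uF uG s0 s3.
set n : R := (size F)%:R in s3; set m : R := (size G)%:R in s3.
have [sF0|sF] := posnP (size F).
  by rewrite /sq_edges (size0nil sF0) big_nil mulr_ge0.
have [sG0|sG] := posnP (size G).
  rewrite /sq_edges (size0nil sG0) big1 ?mulr_ge0 // => x _.
  by rewrite big_nil.
have n0 : 0 < n by rewrite ltr0n.
have m0 : 0 < m by rewrite ltr0n.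
pose e x := (x %/ (M ^ 2)%N)%Z.
have MM : (0 < M ^ 2)%N by rewrite expn_gt0 M0.
have eP x : (e x * (M ^ 2)%N%:Z <= x < e x * (M ^ 2)%N%:Z + (M ^ 2)%N%:Z)%R.
  have r0 : 0 <= (x %% (M ^ 2)%N)%Z by rewrite modz_ge0 //; lia.
  have r1 : (x %% (M ^ 2)%N)%Z < (M ^ 2)%N by rewrite ltz_pmod //; lia.
  have := divz_eq x (M ^ 2)%N; rewrite -/(e x); lia.
rewrite (sq_edges_blocks _ _ e).
pose u i : R := (size [seq x <- F | e x == i])%:R / n.
pose v j : R := (size [seq y <- G | e y == j])%:R / m.
(* Since [M^2 <= k^2 < 4 M^2], an edge climbs at least one window and at most four. *)
pose near (i j : int) : bool := (1 <= j - i <= 4)%R.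
have u01 i : 0 <= u i <= 1.
  rewrite divr_ge0 ?(ltW n0) // ler_pdivrMr // mul1r ler_nat.
  by rewrite size_filter count_size.
have v01 j : 0 <= v j <= 1.
  rewrite divr_ge0 ?(ltW m0) // ler_pdivrMr // mul1r ler_nat.
  by rewrite size_filter count_size.
have blk i j : sq_edges R M (2 * M) [seq x <- F | e x == i] [seq y <- G | e y == j] <=
    (near i j)%:R * (s * ((u i + v j) / 2)).
  have [nij|nij] := boolP (near i j).
    rewrite mul1r; apply: cube_le_mean => //; first exact: sq_edges_ge0.
    apply: (le_trans (sq_edges_windows_le (x0 := i * (M ^ 2)%N) (y0 := j * (M ^ 2)%N)
              _ M0 _ _ _ _)); rewrite ?filter_uniq //.
    - by move=> x; rewrite mem_filter => /andP[/eqP <- _]; exact: eP.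
    - by move=> y; rewrite mem_filter => /andP[/eqP <- _]; exact: eP.
    rewrite s3 /u /v le_eqVlt; apply/orP; left; apply/eqP; field.
    by rewrite !gt_eqF.
  rewrite mul0r /sq_edges big1_seq // => x /andP[_]; rewrite mem_filter => /andP[/eqP xi _].
  rewrite big1_seq // => y /andP[_]; rewrite mem_filter => /andP[/eqP yj _].
  case: sq_inP => // -[k kM yx]; case/negP: nij.
  have := eP x; have := eP y; rewrite xi yj => yb xb.
  have k1 : (M ^ 2 <= k ^ 2)%N by rewrite leq_exp2r //; lia.
  have k2 : (k ^ 2 < 4 * M ^ 2)%N.
    by rewrite (_ : 4 * M ^ 2 = (2 * M) ^ 2)%N ?ltn_exp2r ?expnMn //; lia.
  move: MM k1 k2 yx yb xb; rewrite /near; move: (M ^ 2)%N (k ^ 2)%N => A B ? ? ? ? ? ?.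
  by apply/andP; split; nia.
apply: (@le_trans _ _ (\sum_(i <- undup (map e F)) \sum_(j <- undup (map e G))
   ((near i j)%:R * (s * ((u i + v j) / 2))))).
  by apply: ler_sum => i _; apply: ler_sum => j _; exact: blk.
have su : \sum_(i <- undup (map e F)) u i = 1.
  by rewrite /u -big_distrl /= -partition_size divff // gt_eqF.
have sv : \sum_(j <- undup (map e G)) v j = 1.
  by rewrite /v -big_distrl /= -partition_size divff // gt_eqF.
have -> : \sum_(i <- undup (map e F)) \sum_(j <- undup (map e G))
     ((near i j)%:R * (s * ((u i + v j) / 2))) =
   s / 2 * (\sum_(i <- undup (map e F)) u i * \sum_(j <- undup (map e G)) (near i j)%:R) +
   s / 2 * (\sum_(j <- undup (map e G)) v j * \sum_(i <- undup (map e F)) (near i j)%:R).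
  rewrite [X in _ = _ + _ * X](eq_bigr
    (fun j => \sum_(i <- undup (map e F)) v j * (near i j)%:R)); last first.
    by move=> j _; rewrite big_distrr.
  rewrite [X in _ = _ + _ * X]exchange_big /= -mulrDr -big_split big_distrr /=.
  apply: eq_bigr => i _; rewrite big_distrr /= -big_split /= big_distrr /=.
  by apply: eq_bigr => j _; field.
have rowb i : \sum_(j <- undup (map e G)) (near i j)%:R <= 4 :> R.
  apply: (@sum_bool_le (near i) [:: i + 1; i + 2; i + 3; i + 4]); first exact: undup_uniq.
  by move=> j; rewrite unfold_in /near !inE; lia.
have colb j : \sum_(i <- undup (map e F)) (near i j)%:R <= 4 :> R.
  apply: (@sum_bool_le (near^~ j) [:: j - 1; j - 2; j - 3; j - 4]); first exact: undup_uniq.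
  by move=> i; rewrite unfold_in /near !inE; lia.
have S1 : \sum_(i <- undup (map e F)) u i * \sum_(j <- undup (map e G)) (near i j)%:R <= 4.
  apply: (@le_trans _ _ (\sum_(i <- undup (map e F)) u i * 4)).
    by apply: ler_sum => i _; rewrite ler_wpM2l //; case/andP: (u01 i).
  by rewrite -big_distrl /= su mul1r.
have S2 : \sum_(j <- undup (map e G)) v j * \sum_(i <- undup (map e F)) (near i j)%:R <= 4.
  apply: (@le_trans _ _ (\sum_(j <- undup (map e G)) v j * 4)).
    by apply: ler_sum => j _; rewrite ler_wpM2l //; case/andP: (v01 j).
  by rewrite -big_distrl /= sv mul1r.
rewrite (_ : 4 * s = s / 2 * 4 + s / 2 * 4); last by field.
by rewrite lerD // ler_wpM2l //; lra.
Qed.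

Lemma sq_edges_pow2_le J F G :
  sq_edges R 1 (2 ^ J) F G <= \sum_(0 <= i < J) sq_edges R (2 ^ i) (2 * 2 ^ i) F G.
Proof.
rewrite /sq_edges [leRHS]exchange_big /=; apply: ler_sum => x _.
rewrite [leRHS]exchange_big /=; apply: ler_sum => y _.
case: sq_inP => [[k /andP[k0 kJ] ->]|_]; last by rewrite sumr_ge0.
have /andP[lo hi] := trunc_log_bounds (isT : 1 < 2)%N k0; set i := trunc_log 2 k in lo hi.
have iJ : (i < J)%N by rewrite -(ltn_exp2l _ _ (isT : 1 < 2)%N) (leq_ltn_trans lo).
rewrite (bigD1_seq i) ?iota_uniq ?mem_index_iota //=.
have -> : sq_in (2 ^ i) (2 * 2 ^ i) (k ^ 2)%N.
  by apply/sq_inP; exists k; rewrite // lo -expnS.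
by rewrite lerDl sumr_ge0.
Qed.

(** The bounds for [k] between [2^i] and [2^(i+1)] grow like [rho ^+ i] with [rho = 2^(1/3) > 1], so
    their sum is of the order of its last term, where [2^i] is about [N]. *)
Lemma sq_edges_global : exists2 C : R, 0 < C &
  forall N F G, (0 < N)%N -> uniq F -> uniq G ->
  sq_edges R 1 N.+1 F G <=
  C * N%:R `^ 3^-1 * ((size F)%:R * (size G)%:R) `^ (2 / 3).
Proof.
pose rho : R := 2 `^ 3^-1.
have rho3 : rho ^+ 3 = 2 by exact: cube_root_powR.
have rho0 : 0 <= rho by exact: powR_ge0.
have rho1 : 1 < rho.
  rewrite ltNge; apply/negP => r1; have : rho ^+ 3 <= 1 by rewrite exprn_ile1.
  by rewrite rho3; lra.
pose c : R := window_const R `^ 3^-1.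
have c3 : c ^+ 3 = window_const R by rewrite cube_root_powR ?window_const_ge0.
have c0 : 0 <= c by exact: powR_ge0.
(* The factor [4] comes from the dyadic bound and [rho / (rho - 1)] from the geometric sum; adding
   [1] ensures positivity. *)
exists (4 * c * (rho / (rho - 1)) + 1).
  by rewrite ltr_wpDl // !mulr_ge0 // invr_ge0; lra.
move=> N F G N0 uF uG; set P : R := (size F)%:R * (size G)%:R.
have P0 : 0 <= P by rewrite mulr_ge0.
set tau := P `^ (2 / 3); have tau0 : 0 <= tau by exact: powR_ge0.
have tau3 : tau ^+ 3 = P ^+ 2.
  rewrite /tau -powR_mulrn ?powR_ge0 // -powRrM -powR_mulrn //.
  by congr (_ `^ _); field.
have /andP[lo hi] := trunc_log_bounds (isT : 1 < 2)%N N0; set J := trunc_log 2 N in lo hi.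
apply: (@le_trans _ _ (sq_edges R 1 (2 ^ J.+1) F G)).
  apply: ler_sum => x _; apply: ler_sum => y _; rewrite ler_nat.
  case: (sq_inP 1 N.+1) => // -[k kN kE].
  suff -> : sq_in 1 (2 ^ J.+1) (y - x) by [].
  by apply/sq_inP; exists k => //; lia.
apply: (le_trans (sq_edges_pow2_le _ _ _)).
apply: (@le_trans _ _ (\sum_(0 <= i < J.+1) 4 * (c * tau) * rho ^+ i)).
  apply: ler_sum => i _; rewrite -mulrA; apply: sq_edges_dyadic_le => //.
  - by rewrite expn_gt0.
  - by rewrite !mulr_ge0 ?exprn_ge0.
  rewrite !exprMn c3 tau3 -exprM mulnC exprM rho3 -natrX /P exprMn; ring.
rewrite -big_distrr /=.
have geo : \sum_(0 <= i < J.+1) rho ^+ i <= rho / (rho - 1) * N%:R `^ 3^-1.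
  have -> : \sum_(0 <= i < J.+1) rho ^+ i = (rho ^+ J.+1 - 1) / (rho - 1).
    rewrite subrX1 big_mkord mulrAC divff ?mul1r // gt_eqF //; lra.
  rewrite mulrAC ler_pM2r ?invr_gt0; last by lra.
  apply: (@le_trans _ _ (rho ^+ J.+1)); first by lra.
  rewrite exprS ler_wpM2l //; apply: ler_cube; rewrite ?exprn_ge0 ?powR_ge0 //.
  by rewrite cube_root_powR // -exprM mulnC exprM rho3 -natrX ler_nat.
have N13 : 0 <= N%:R `^ 3^-1 :> R by exact: powR_ge0.
apply: (le_trans (ler_wpM2l _ geo)); first by rewrite !mulr_ge0.
have -> : 4 * (c * tau) * (rho / (rho - 1) * N%:R `^ 3^-1) =
  4 * c * (rho / (rho - 1)) * N%:R `^ 3^-1 * tau by ring.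
by rewrite ler_wpM2r // ler_wpM2r // lerDl.
Qed.

End GlobalSquareGraph.

(** * Level sets and pairs with a large product *)

Section Bilinear.
Variable R : realType.
Implicit Types (N : nat) (X Y : seq int) (g f : int -> R).
Local Notation K N x y := ((sq_in 1 N.+1 (y - x))%:R : R).

Lemma sum_sq_row_le N Y x : uniq Y -> \sum_(y <- Y) K N x y <= N%:R.
Proof.
move=> uY; rewrite -[N in leRHS](size_iota 1 N) -(size_map (fun k : nat => x + (k ^ 2)%N%:Z)).
apply: (@sum_bool_le R (fun y => sq_in 1 N.+1 (y - x)) _ Y uY) => y.
rewrite unfold_in => /sq_inP[k kN yx]; apply/mapP; exists k; first by rewrite mem_iota; lia.
by rewrite -yx addrC subrK.
Qed.

Lemma sum_sq_col_le N X y : uniq X -> \sum_(x <- X) K N x y <= N%:R.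
Proof.
move=> uX; rewrite -[N in leRHS](size_iota 1 N) -(size_map (fun k : nat => y - (k ^ 2)%N%:Z)).
apply: (@sum_bool_le R (fun x => sq_in 1 N.+1 (y - x)) _ X uX) => x.
rewrite unfold_in => /sq_inP[k kN yx]; apply/mapP; exists k; first by rewrite mem_iota; lia.
by rewrite -yx opprB addrC subrK.
Qed.

Lemma geometric_uniq_le (r : R) (s : seq nat) : 0 <= r < 1 -> uniq s ->
  \sum_(k <- s) r ^+ k <= (1 - r)^-1.
Proof.
move=> /andP[r0 r1] us; pose m := (\max_(k <- s) k).+1.
apply: (@le_trans _ _ (\sum_(k <- index_iota 0 m) r ^+ k)).
  apply: ler_sum_subset; rewrite ?iota_uniq // => k; last by rewrite exprn_ge0.
  by move=> ks; rewrite mem_index_iota /m ltnS /=; apply: leq_bigmax_seq.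
rewrite -[leRHS]mul1r ler_pdivlMr ?subr_gt0 //.
have := subrX1 r m; rewrite -[X in _ = (r - 1) * X](big_mkord xpredT (fun i => r ^+ i)).
set S := \sum_(0 <= i < m) _; have := exprn_ge0 m r0; nra.
Qed.

(** With [m] the floor of [L], the [j] that contribute have distinct natural exponents [i + j - m];
    rounding costs the [- 1] in [L - 1]. *)
Lemma geometric_int_le (kap L : R) (J : seq int) (i : int) : 0 < kap -> uniq J ->
  \sum_(j <- J) (L < (i + j)%:~R)%R%:R * expR (- kap * (i + j)%:~R) <=
  expR (- kap * (L - 1)) / (1 - expR (- kap)) :> R.
Proof.
move=> k0 uJ; set r := expR (- kap).
have r1 : r < 1 by rewrite /r -expR0 ltr_expR; lra.
have r0 : 0 <= r by exact: expR_ge0.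
pose m := Num.floor L.
have mL : L - 1 <= m%:~R by have := floorD1_gt L; rewrite intrD -/m /=; lra.
apply: (@le_trans _ _ (expR (- kap * m%:~R) *
    \sum_(j <- [seq j <- J | L < (i + j)%:~R]) r ^+ absz (i + j - m)%R)).
  rewrite big_distrr /= big_filter [leRHS]big_mkcond ler_sum // => j _.
  case: ifP => Lj; last by rewrite mul0r.
  have mj : (m <= i + j)%R.
    by rewrite -(ler_int R); apply: le_trans (ltW Lj); exact: floor_le.
  rewrite mul1r /r -expRM_natl -expRD ler_expR.
  have -> : (absz (i + j - m)%R)%:R = (i + j - m)%:~R :> R.
    by rewrite pmulrn; congr (_%:~R); lia.
  by rewrite [in leRHS]intrB; lra.
rewrite ler_pM ?expR_ge0 ?sumr_ge0 // => [j _||].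
- exact: exprn_ge0.
- by rewrite ler_expR; nra.
rewrite -(big_map (fun j => absz (i + j - m)%R) xpredT (fun k => r ^+ k)).
apply: geometric_uniq_le; first by rewrite r0.
rewrite map_inj_in_uniq ?filter_uniq // => j j'; rewrite !mem_filter => /andP[h _] /andP[h' _].
have mj z : L < z%:~R -> (m <= z)%R.
  by move=> Lz; rewrite -(ler_int R); apply: le_trans (ltW Lz); exact: floor_le.
by have := mj _ h; have := mj _ h'; lia.
Qed.

Lemma powR_expR (a b : R) : expR a `^ b = expR (a * b).
Proof. by rewrite /powR gt_eqF ?expR_gt0 // expRK mulrC. Qed.

Lemma powR23_le_mean (u v : R) : 0 <= u <= 1 -> 0 <= v <= 1 -> (u * v) `^ (2 / 3) <= (u + v) / 2.
Proof.
move=> hu hv; have uv0 : 0 <= u * v by case/andP: hu hv => ? _ /andP[? _]; rewrite mulr_ge0.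
rewrite -[leRHS]mul1r; apply: cube_le_mean => //; first exact: powR_ge0.
rewrite expr1n mul1r -powR_mulrn ?powR_ge0 // -powRrM -powR_mulrn //.
by rewrite (_ : 2 / 3 * 3%:R = 2%:R) //; field.
Qed.

Definition level g (x : int) : int := Num.floor (ln (g x)).

Lemma levelP g x : 0 < g x -> expR (level g x)%:~R <= g x < expR ((level g x)%:~R + 1).
Proof.
move=> g0; have := floor_itv (ln (g x)); rewrite -/(level g x) intrD /= => /andP[lo hi].
by rewrite -[g x in X in X && _]lnK ?posrE // ler_expR lo /= -[g x in ltLHS]lnK ?posrE // ltr_expR.
Qed.

(** Chebyshev: [g^p] is at least [exp (i p)] on level [i], so [u i] is at most the share of that
    level in the sum of [g^p]. *)
Lemma level_mass (p : R) g X : 0 <= p -> {in X, forall x, 0 < g x} ->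
  \sum_(x <- X) g x `^ p <= 1 ->
  let u i := expR (i%:~R * p) * (size [seq x <- X | level g x == i])%:R in
  (forall i, 0 <= u i <= 1) /\ \sum_(i <- undup (map (level g) X)) u i <= 1.
Proof.
move=> p0 g0 gX u.
have u0 i : 0 <= u i by rewrite mulr_ge0 ?expR_ge0.
have uE i : u i <= \sum_(x <- X | level g x == i) g x `^ p.
  rewrite /u mulr_natr -big_filter -sumr_const_seq big_seq [leRHS]big_seq ler_sum // => x.
  rewrite mem_filter => /andP[/eqP <- /g0 gx0].
  rewrite -powR_expR ge0_ler_powR ?nnegrE ?expR_ge0 ?(ltW gx0) //.
  by case/andP: (levelP gx0).
split=> [i|]; last by apply: le_trans gX; rewrite [leRHS](partition_sum (level g)) ler_sum.
rewrite u0 (le_trans (uE i)) // (le_trans _ gX) // big_mkcond ler_sum // => x _.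
by case: ifP => // _; exact: powR_ge0.
Qed.

(** On levels [i, j] the product is at most [exp (i + j + 2)], and the edge bound is [C exp (- (2 p
    / 3) (i + j)) (u i * v j)^(2/3)]. Together they decay like [exp (- kap (i + j))], while the
    power of [u i * v j] is at most the mean of [u i] and [v j]; so one index is summed
    geometrically and the other by mass. *)
Lemma sum_high_levels_le (p C lam kap : R) N X Y g f : kap = 2 * p / 3 - 1 ->
  0 < kap -> 0 < C -> 0 < lam ->
  (forall F G, uniq F -> uniq G -> sq_edges R 1 N.+1 F G <=
     C * ((size F)%:R * (size G)%:R) `^ (2 / 3)) ->
  uniq X -> uniq Y -> {in X, forall x, 0 < g x} -> {in Y, forall y, 0 < f y} ->
  \sum_(x <- X) g x `^ p <= 1 -> \sum_(y <- Y) f y `^ p <= 1 ->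
  \sum_(x <- X) \sum_(y <- Y) K N x y * (lam < g x * f y)%R%:R * (g x * f y) <=
  C * expR 2 * (expR (- kap * (ln lam - 3)) / (1 - expR (- kap))).
Proof.
move=> kapE k0 C0 lam0 HC uX uY g0 f0 gX fY.
have p0 : 0 <= p by lra.
have [] := level_mass p0 g0 gX; set u := (X in forall i, 0 <= X i <= 1) => u01 su.
have [] := level_mass p0 f0 fY; set v := (X in forall i, 0 <= X i <= 1) => v01 sv.
set I := undup (map (level g) X) in su *; set J := undup (map (level f) Y) in sv *.
(* A product above [lam] forces [exp (i + j + 2) > lam]. *)
pose hi (i j : int) : R := (ln lam - 2 < (i + j)%:~R)%R%:R.
set S := expR (- kap * (ln lam - 3)) / (1 - expR (- kap)).
have S0 : 0 <= S.
  rewrite divr_ge0 ?expR_ge0 // subr_ge0 -expR0 ler_expR; lra.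
pose w i j := hi i j * expR (- kap * (i + j)%:~R).
have w0 i j : 0 <= w i j by rewrite mulr_ge0 ?expR_ge0.
have lev i j : \sum_(x <- X | level g x == i) \sum_(y <- Y | level f y == j)
    K N x y * (lam < g x * f y)%R%:R * (g x * f y) <=
    C * expR 2 * (w i j * ((u i + v j) / 2)).
  set Xi := [seq x <- X | level g x == i]; set Yj := [seq y <- Y | level f y == j].
  apply: (@le_trans _ _ (hi i j * expR ((i + j)%:~R + 2) * sq_edges R 1 N.+1 Xi Yj)).
    rewrite /sq_edges big_distrr /= -[leLHS]big_filter -/Xi big_seq [leRHS]big_seq ler_sum //= => x.
    rewrite mem_filter => /andP[/eqP xi xX].
    rewrite big_distrr /= -[leLHS]big_filter -/Yj big_seq [leRHS]big_seq ler_sum //= => y.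
    rewrite mem_filter => /andP[/eqP yj yY].
    have /andP[_ gx] := levelP (g0 _ xX); have /andP[_ fy] := levelP (f0 _ yY).
    have gf : g x * f y <= expR ((i + j)%:~R + 2).
      rewrite (_ : (i + j)%:~R + 2 = (i%:~R + 1) + (j%:~R + 1)); last by rewrite intrD; ring.
      rewrite expRD ler_pM // ?ltW ?g0 ?f0 //; first by rewrite -xi.
      by rewrite -yj.
    rewrite -mulrA mulrC ler_wpM2r //.
    have [lgf|_] := boolP (lam < g x * f y); last first.
      by rewrite mul0r mulr_ge0 ?expR_ge0.
    rewrite mul1r /hi; have -> : ln lam - 2 < (i + j)%:~R.
      rewrite ltrBlDr -[ltRHS]expRK ltr_ln ?posrE ?expR_gt0 //.
      exact: lt_le_trans lgf gf.
    by rewrite mul1r.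
  have e0 z : 0 < expR z :> R by exact: expR_gt0.
  apply: (@le_trans _ _ (hi i j * expR ((i + j)%:~R + 2) *
     (C * (expR (- ((i + j)%:~R * p) * (2 / 3)) * ((u i + v j) / 2))))).
    rewrite ler_wpM2l ?mulr_ge0 ?expR_ge0 //.
    apply: (le_trans (HC _ _ _ _)); rewrite ?filter_uniq // ler_pM2l //.
    apply: (@le_trans _ _ (expR (- ((i + j)%:~R * p) * (2 / 3)) * (u i * v j) `^ (2 / 3))).
      rewrite -powR_expR -powRM ?expR_ge0 //; last first.
        by case/andP: (u01 i) => ? _; case/andP: (v01 j) => ? _; rewrite mulr_ge0.
      rewrite le_eqVlt; apply/orP; left; apply/eqP; congr (_ `^ _).
      have -> : expR (- ((i + j)%:~R * p)) = (expR (i%:~R * p) * expR (j%:~R * p))^-1.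
        by rewrite -expRD -expRN intrD mulrDl.
      by rewrite /u /v /Xi /Yj /=; field; rewrite !gt_eqF.
    rewrite ler_pM2l //; exact: powR23_le_mean.
  rewrite le_eqVlt; apply/orP; left; apply/eqP; rewrite /w.
  rewrite (_ : expR (- kap * (i + j)%:~R) =
     expR (i + j)%:~R * expR (- ((i + j)%:~R * p) * (2 / 3))); last first.
    by rewrite -expRD kapE; congr expR; field.
  by rewrite expRD; ring.
rewrite (partition_sum (level g)) -/I.
apply: (@le_trans _ _ (\sum_(i <- I) \sum_(j <- J) C * expR 2 * (w i j * ((u i + v j) / 2)))).
  apply: ler_sum => i _; apply: le_trans (ler_sum _ (fun j _ => lev i j)).
  rewrite [leRHS]exchange_big /=; apply: ler_sum => x _.
  by rewrite (partition_sum (level f)).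
have -> : \sum_(i <- I) \sum_(j <- J) C * expR 2 * (w i j * ((u i + v j) / 2)) =
   C * expR 2 * ((\sum_(i <- I) u i * \sum_(j <- J) w i j +
                  \sum_(j <- J) v j * \sum_(i <- I) w i j) / 2).
  rewrite (eq_bigr (fun j => \sum_(i <- I) v j * w i j) (r := J)); last first.
    by move=> j _; rewrite big_distrr.
  rewrite [X in _ = _ * ((_ + X) / 2)]exchange_big /= -big_split /= big_distrl big_distrr /=.
  apply: eq_bigr => i _; rewrite big_distrr /= -big_split /= big_distrl big_distrr /=.
  by apply: eq_bigr => j _; field.
rewrite ler_pM2l; last by rewrite mulr_gt0 ?expR_gt0.
have geo (A : seq int) i : uniq A -> \sum_(j <- A) w i j <= S.
  move=> uA; rewrite /S (_ : ln lam - 3 = (ln lam - 2) - 1); last by ring.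
  exact: geometric_int_le.
have part (A B : seq int) (a : int -> R) (h : int -> int -> R) :
    (forall i, \sum_(j <- B) h i j <= S) -> (forall i, 0 <= a i) ->
    \sum_(i <- A) a i <= 1 -> \sum_(i <- A) a i * \sum_(j <- B) h i j <= S.
  move=> hS a0 a1; apply: (@le_trans _ _ (\sum_(i <- A) a i * S)).
    by apply: ler_sum => i _; rewrite ler_wpM2l.
  by rewrite -big_distrl /= -[leRHS]mul1r ler_wpM2r.
rewrite ler_pdivrMr // mulr_natr mulr2n lerD //.
  by apply: part => // i; [exact/geo/undup_uniq|case/andP: (u01 i)].
apply: (part _ _ _ (fun j i => w i j)) => // j; last by case/andP: (v01 j).
have wC i : w i j = w j i by rewrite /w /hi [i + j]addrC.
under eq_bigr do rewrite wC.
exact/geo/undup_uniq.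
Qed.

End Bilinear.

(** * The bilinear bound and duality *)

Section Averages.
Variable R : realType.
Implicit Types (N : nat) (X Y : seq int) (g f : int -> R).
Local Notation K N x y := ((sq_in 1 N.+1 (y - x))%:R : R).

(** Write [a b = (a b)^(1 - p/2) (a b)^(p/2)]: the first exponent is nonnegative as [p <= 2], and
    the second factor is handled by the arithmetic-geometric mean inequality. *)
Lemma mulr_le_powR_mean (p a b lam : R) : 0 < p -> p <= 2 -> 0 <= a -> 0 <= b ->
  a * b <= lam -> a * b <= lam `^ (1 - p / 2) * ((a `^ p + b `^ p) / 2).
Proof.
move=> p0 p2 a0 b0 ab; have ab0 : 0 <= a * b by rewrite mulr_ge0.
have sq c : 0 <= c -> (c `^ (p / 2)) ^+ 2 = c `^ p.
  by move=> c0; rewrite -powR_mulrn ?powR_ge0 // -powRrM divfK.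
rewrite -[leLHS]powRr1 // -[1 in leLHS](subrK (p / 2)) powRD; last first.
  by rewrite subrK oner_eq0.
rewrite ler_pM ?powR_ge0 //.
  apply: ge0_ler_powR => //; rewrite ?nnegrE ?(le_trans ab0 ab) //; lra.
rewrite powRM // -!sq //.
by have := sqr_ge0 (a `^ (p / 2) - b `^ (p / 2)); nra.
Qed.

(** A Schur test: every row and column sum of the graph is at most [N]. *)
Lemma sum_low_le N X Y (a b : int -> R) : uniq X -> uniq Y ->
  (forall x, 0 <= a x) -> (forall y, 0 <= b y) ->
  \sum_(x <- X) a x <= 1 -> \sum_(y <- Y) b y <= 1 ->
  \sum_(x <- X) \sum_(y <- Y) K N x y * ((a x + b y) / 2) <= N%:R.
Proof.
move=> uX uY a0 b0 a1 b1.
have -> : \sum_(x <- X) \sum_(y <- Y) K N x y * ((a x + b y) / 2) =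
   (\sum_(x <- X) a x * \sum_(y <- Y) K N x y + \sum_(y <- Y) b y * \sum_(x <- X) K N x y) / 2.
  rewrite (eq_bigr (fun y => \sum_(x <- X) b y * K N x y) (r := Y)); last first.
    by move=> y _; rewrite big_distrr.
  rewrite [X in _ = (_ + X) / 2]exchange_big /= -big_split /= big_distrl /=.
  apply: eq_bigr => x _; rewrite big_distrr /= -big_split /= big_distrl /=.
  by apply: eq_bigr => y _; field.
have part (Z : seq int) (c h : int -> R) : (forall i, 0 <= c i) -> \sum_(i <- Z) c i <= 1 ->
    (forall i, h i <= N%:R) -> \sum_(i <- Z) c i * h i <= N%:R.
  move=> c0 c1 hN; apply: (@le_trans _ _ (\sum_(i <- Z) c i * N%:R)).
    by apply: ler_sum => i _; rewrite ler_wpM2l.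
  by rewrite -big_distrl /= -[leRHS]mul1r ler_wpM2r.
rewrite ler_pdivrMr // mulr_natr mulr2n lerD //; apply: part => // i.
  exact: sum_sq_row_le.
exact: sum_sq_col_le.
Qed.

Lemma bilinear_le (p : R) : 3 / 2 < p -> p <= 2 -> exists2 C : R, 0 < C &
  forall N X Y g f, (0 < N)%N -> uniq X -> uniq Y ->
  (forall x, 0 <= g x) -> (forall y, 0 <= f y) ->
  \sum_(x <- X) g x `^ p <= 1 -> \sum_(y <- Y) f y `^ p <= 1 ->
  \sum_(x <- X) \sum_(y <- Y) K N x y * (g x * f y) <= C * N%:R `^ (3 - 4 / p).
Proof.
move=> p32 p2; have [C1 C10 HC] := sq_edges_global R.
have p0 : 0 < p by lra.
pose kap := 2 * p / 3 - 1; have k0 : 0 < kap by rewrite /kap; lra.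
pose C2 := C1 * expR 2 * (expR (3 * kap) / (1 - expR (- kap))).
have C20 : 0 < C2.
  rewrite !mulr_gt0 ?expR_gt0 // invr_gt0 subr_gt0 -expR0 ltr_expR; lra.
exists (1 + C2); first by lra.
move=> N X Y g f N0 uX uY g0 f0 gX fY.
have NR : 0 < N%:R :> R by rewrite ltr0n.
have powN a : N%:R `^ a = expR (a * ln N%:R) :> R by rewrite /powR gt_eqF.
(* The threshold is [N^(-4/p)], where both parts agree: [N lam^(1 - p/2)] and [N^(1/3) lam^(-kap)]
   are each [N^(3 - 4/p)]. *)
pose lam : R := expR (- (4 / p) * ln N%:R); have lam0 : 0 < lam by exact: expR_gt0.
have K0 x y : 0 <= K N x y by exact: ler0n.
apply: (@le_trans _ _ (\sum_(x <- X) \sum_(y <- Y)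
    (lam `^ (1 - p / 2) * (K N x y * ((g x `^ p + f y `^ p) / 2)) +
     K N x y * (lam < g x * f y)%R%:R * (g x * f y)))).
  apply: ler_sum => x _; apply: ler_sum => y _.
  rewrite [lam `^ _ * _]mulrCA -[_ * _ * (g x * f y)]mulrA -mulrDr ler_wpM2l //.
  have [gf|gf] := leP (g x * f y) lam.
    by rewrite mul0r addr0; exact: mulr_le_powR_mean.
  by rewrite mul1r lerDr !mulr_ge0 ?addr_ge0 ?powR_ge0.
under eq_bigr do rewrite big_split -big_distrr /=.
rewrite big_split -big_distrr /= mulrDl lerD //.
  apply: (@le_trans _ _ (lam `^ (1 - p / 2) * N%:R)).
    rewrite ler_wpM2l ?powR_ge0 //; apply: sum_low_le => // z; exact: powR_ge0.
  rewrite mul1r powN /lam powR_expR -[X in _ * X]lnK ?posrE // -expRD ler_expR.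
  rewrite le_eqVlt; apply/orP; left; apply/eqP; field.
  by rewrite gt_eqF.
(* Levels are logarithmic, so the points where a function vanishes are discarded first. *)
pose X' := [seq x <- X | 0 < g x]; pose Y' := [seq y <- Y | 0 < f y].
have sub (Z : seq int) (c : int -> R) : (forall z, 0 <= c z) ->
    \sum_(z <- [seq z <- Z | 0 < c z]) c z `^ p = \sum_(z <- Z) c z `^ p.
  move=> c0; rewrite big_filter big_mkcond; apply: eq_bigr => z _.
  case: ltP => // cz; have -> : c z = 0 by apply/le_anti; rewrite cz c0.
  by rewrite powR0 // gt_eqF.
have -> : \sum_(x <- X) \sum_(y <- Y) K N x y * (lam < g x * f y)%R%:R * (g x * f y) =
   \sum_(x <- X') \sum_(y <- Y') K N x y * (lam < g x * f y)%R%:R * (g x * f y).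
  rewrite big_filter [RHS]big_mkcond; apply: eq_bigr => x _; case: (ltP 0 (g x)) => gx; last first.
    have -> : g x = 0 by apply/le_anti; rewrite gx g0.
    by rewrite big1 // => y _; rewrite mul0r mulr0.
  rewrite big_filter [RHS]big_mkcond; apply: eq_bigr => y _; case: (ltP 0 (f y)) => // fy.
  have -> : f y = 0 by apply/le_anti; rewrite fy f0.
  by rewrite !mulr0.
apply: (le_trans (sum_high_levels_le (p := p) (C := C1 * N%:R `^ 3^-1) (lam := lam)
  (kap := kap) (N := N) erefl k0 _ lam0 _ _ _ _ _ _ _)); rewrite ?filter_uniq ?sub //.
- by rewrite mulr_gt0 // powR_gt0.
- by move=> F G uF uG; exact: HC.
- by move=> x; rewrite mem_filter => /andP[].
- by move=> y; rewrite mem_filter => /andP[].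
rewrite /lam expRK !powN.
have -> : (3 - 4 / p) * ln N%:R = 3^-1 * ln N%:R + kap * (4 / p) * ln N%:R :> R.
  by rewrite /kap; field; rewrite gt_eqF.
have -> : - kap * (- (4 / p) * ln N%:R - 3) = kap * (4 / p) * ln N%:R + 3 * kap by ring.
rewrite /C2 !expRD le_eqVlt; apply/orP; left; apply/eqP; ring.
Qed.

(** Test the average [h] of [|f|] against the extremal function [h^(q-1)], normalised in [l^p] since
    [(q - 1) p = q]. The bilinear bound then gives [W / w = W^(1/q)], and dividing by [N] turns the
    exponent [3 - 4/p] into [2 - 4/p = 2/q - 2/p]. *)
Lemma avg_sq_dual_le (p : R) : 3 / 2 < p -> p <= 2 -> exists2 C : R, 0 < C &
  forall N X f (S : R), (0 < N)%N -> uniq X ->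
  (forall Y, uniq Y -> \sum_(y <- Y) `|f y| `^ p <= S) ->
  \sum_(x <- X) `|avg_sq N f x| `^ conj_exp p <=
  (C * N%:R `^ (2 / conj_exp p - 2 / p) * S `^ p^-1) `^ conj_exp p.
Proof.
move=> p32 p2; have [C C0 HB] := bilinear_le p32 p2; exists C => //.
move=> N X f S N0 uX fS; set q := conj_exp p.
have p0 : 0 < p by lra.
have p1 : 0 < p - 1 by lra.
have q0 : 0 < q by rewrite divr_gt0.
have NR : 0 < N%:R :> R by rewrite ltr0n.
have S0 : 0 <= S by have := fS [::] isT; rewrite big_nil.
pose h x := N%:R^-1 * \sum_(1 <= k < N.+1) `|f (x + (k ^ 2)%N%:Z)|.
have h0 x : 0 <= h x by rewrite mulr_ge0 ?invr_ge0 ?sumr_ge0 // ltW.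
set W := \sum_(x <- X) h x `^ q.
have W0 : 0 <= W by rewrite sumr_ge0 // => x _; exact: powR_ge0.
apply: (@le_trans _ _ W).
  apply: ler_sum => x _; rewrite ge0_ler_powR ?nnegrE ?(ltW q0) //.
  rewrite /avg_sq normrM ger0_norm ?invr_ge0 ?(ltW NR) // ler_wpM2l ?invr_ge0 ?(ltW NR) //.
  exact: ler_norm_sum.
have [W_0|Wn0] := eqVneq W 0; first by rewrite W_0 powR_ge0.
have Wgt0 : 0 < W by rewrite lt_def Wn0.
(* The case [S = 0] is separate because [f] is about to be divided by [S^(1/p)]; here [f] vanishes
   and so does [h]. *)
have [S_0|Sn0] := eqVneq S 0.
  case/eqP: Wn0; rewrite /W big1 // => x _.
  suff -> : h x = 0 by rewrite powR0 // gt_eqF.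
  rewrite /h big1 ?mulr0 // => k _; apply: (@powR_eq0_eq0 _ _ p); apply/le_anti.
  by rewrite powR_ge0 andbT -S_0; have := fS [:: x + (k ^ 2)%N%:Z] isT; rewrite big_seq1.
have Sgt0 : 0 < S by rewrite lt_def Sn0.
set s := S `^ p^-1; have s0 : 0 < s by exact: powR_gt0.
have sp : s `^ p = S by rewrite /s -powRrM mulVf ?powRr1 // gt_eqF.
pose w := W `^ p^-1; have w0 : 0 < w by exact: powR_gt0.
have wp : w `^ p = W by rewrite /w -powRrM mulVf ?powRr1 // gt_eqF.
pose g x := h x `^ (q - 1) / w; pose f1 y := `|f y| / s.
have powV (c a : R) : 0 <= c -> 0 < a -> (c / a) `^ p = c `^ p / a `^ p.
  by move=> c0 a0; rewrite powRM ?invr_ge0 ?(ltW a0) // -(powR_inv1 (ltW a0)) -powRrM mulN1r powRN.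
(* All the points that the averages over [X] look at. *)
pose Y := undup [seq x + (k ^ 2)%N%:Z | x <- X, k <- index_iota 1 N.+1].
have g_ge0 x : 0 <= g x by rewrite divr_ge0 ?powR_ge0 // ltW.
have f1_ge0 y : 0 <= f1 y by rewrite divr_ge0 // ltW.
have gX : \sum_(x <- X) g x `^ p <= 1.
  rewrite (eq_bigr (fun x => h x `^ q / W)) => [|x _].
    by rewrite -big_distrl /= -/W divff.
  rewrite powV ?powR_ge0 // wp -powRrM (_ : (q - 1) * p = q) //.
  by rewrite /q /conj_exp; field; rewrite gt_eqF.
have fY : \sum_(y <- Y) f1 y `^ p <= 1.
  rewrite (eq_bigr (fun y => `|f y| `^ p / S)) => [|y _]; last by rewrite powV // sp.
  by rewrite -big_distrl /= ler_pdivrMr // mul1r fS // undup_uniq.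
have H := HB N X Y g f1 N0 uX (undup_uniq _) g_ge0 f1_ge0 gX fY.
have rows x : x \in X -> N%:R * h x <= \sum_(y <- Y) K N x y * `|f y|.
  move=> xX; rewrite /h mulVKf ?gt_eqF //.
  pose Z := [seq x + (k ^ 2)%N%:Z | k <- index_iota 1 N.+1].
  have -> : \sum_(1 <= k < N.+1) `|f (x + (k ^ 2)%N%:Z)| = \sum_(y <- Z) K N x y * `|f y|.
    rewrite big_map; apply: eq_big_seq => k; rewrite mem_index_iota => kN.
    rewrite addrAC subrr add0r.
    have -> : sq_in 1 N.+1 (k ^ 2)%N by apply/sq_inP; exists k.
    by rewrite mul1r.
  apply: ler_sum_subset; rewrite ?undup_uniq //.
  - rewrite map_inj_in_uniq ?iota_uniq // => k k'; rewrite !mem_index_iota => kN kN' /addrI [].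
    by move=> /eqP; rewrite eqn_exp2r // => /eqP.
  - move=> y /mapP[k kN ->]; rewrite mem_undup; exact: allpairs_f.
have lower : N%:R * W / (w * s) <= \sum_(x <- X) \sum_(y <- Y) K N x y * (g x * f1 y).
  rewrite /W big_distrr big_distrl /= big_seq [leRHS]big_seq ler_sum // => x xX.
  have -> : \sum_(y <- Y) K N x y * (g x * f1 y) = g x / s * \sum_(y <- Y) K N x y * `|f y|.
    by rewrite big_distrr; apply: eq_bigr => y _ /=; rewrite /f1; ring.
  apply: le_trans (ler_wpM2l _ (rows x xX)); last by rewrite divr_ge0 // ltW.
  rewrite le_eqVlt; apply/orP; left; apply/eqP.
  rewrite -(mulr_powRB1 (h0 x) q0) /g; field.
  by rewrite !gt_eqF.
have {lower}H := le_trans lower H.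
have Wq : W = (W / w) `^ q.
  rewrite /w -{2}(powRr1 W0) -powRB; last by rewrite Wn0 implybT.
  rewrite -powRrM (_ : (1 - p^-1) * q = 1) ?powRr1 // /q /conj_exp; field.
  by rewrite !gt_eqF.
rewrite [leLHS]Wq ge0_ler_powR ?nnegrE ?(ltW q0) ?divr_ge0 ?(ltW w0) //.
  by rewrite !mulr_ge0 ?powR_ge0 // ltW.
have e3 : N%:R `^ (3 - 4 / p) = N%:R * N%:R `^ (2 / q - 2 / p) :> R.
  rewrite (_ : 3 - 4 / p = 1 + (2 / q - 2 / p)).
    rewrite powRD ?powRr1 ?(ltW NR) //.
    by rewrite (gt_eqF NR) implybT.
  by rewrite /q /conj_exp; field; rewrite !gt_eqF.
move: H; rewrite e3 ler_pdivrMr ?mulr_gt0 //.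
rewrite ler_pdivrMr // => H; rewrite -(ler_pM2l NR); apply: (le_trans H).
rewrite le_eqVlt; apply/orP; left; apply/eqP; ring.
Qed.

End Averages.

(** * Passage from finite sums to the norms *)

Theorem theorem1 (R : realType) (p : R) (hp1 : 3 / 2 < p) (hp2 : p <= 2) :
  exists C : R, 0 < C /\
    forall (N : nat) (f : int -> R), (0 < N)%N ->
      (lpnorm (conj_exp p) (avg_sq N f) <=
        (C * (N%:R `^ (2 / conj_exp p - 2 / p)))%:E * lpnorm p f)%E.
Proof.
have [C C0 HC] := avg_sq_dual_le hp1 hp2; exists C; split=> // N f N0.
have p0 : 0 < p by lra.
have q0 : 0 < conj_exp p by rewrite /conj_exp divr_gt0 //; lra.
set c := C * _; have c0 : 0 < c by rewrite mulr_gt0 // powR_gt0 // ltr0n.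
rewrite /lpnorm; set E := (\esum_(x in _) (`|f x| `^ p)%:E)%E.
have E0 : (0 <= E)%E by apply: esum_ge0 => x _; rewrite lee_fin powR_ge0.
(* If the norm of [f] is infinite, so is the right-hand side, because [c > 0]. *)
have [Ey|Efin] := eqVneq E +oo%E.
  by rewrite Ey poweRyr ?gt0_muley ?leey ?lte_fin // invr_neq0 // gt_eqF.
have {}Efin : E \is a fin_num by rewrite ge0_fin_numE // lt_neqAle Efin leey.
set S := fine E; have ES : E = S%:E by rewrite fineK.
have fS Y : uniq Y -> \sum_(y <- Y) `|f y| `^ p <= S.
  move=> uY; rewrite -lee_fin -ES -sumEFin /E; apply: ereal_sup_ubound.
  exists [set` Y]%classic; last exact/esym/fsbig_seq.
  by split=> //; exact: finite_seq.
(* The sum is a supremum over finite sets, and the duality bound is uniform in them. *)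
have fin : (\esum_(x in [set: int]) (`|avg_sq N f x| `^ conj_exp p)%:E <=
    ((c * S `^ p^-1) `^ conj_exp p)%:E)%E.
  apply: ub_ereal_sup => _ [A [fA _] <-]; rewrite fsbig_finite //= sumEFin lee_fin.
  by apply: HC => //; exact: finmap.fset_uniq.
apply: (le_trans (gt0_ler_poweR _ _ _ fin)).
- by rewrite invr_ge0 ltW.
- by rewrite in_itv /= leey andbT; apply: esum_ge0 => x _; rewrite lee_fin powR_ge0.
- by rewrite in_itv /= leey andbT lee_fin powR_ge0.
rewrite ES !poweR_EFin -EFinM lee_fin -powRrM mulfV ?gt_eqF // powRr1 //.
by rewrite mulr_ge0 ?powR_ge0 // ltW.
Qed.
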